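(* Let $k^\circ\subset k$ be a field extension, let $q\in k\setminus k^\circ$ be transcendental over $k^\circ$, and let $R=k^\circ[q,q^{-1}]\subset k$. Let $H$ be an $R$-bialgebra and $B$ a left $H$-comodule with structure map $\lambda:B\to H\otimes_R B$, and let $\phi:A\to B$ be an $R$-module homomorphism (from an $R$-module $A$) whose image is contained in $B^{\mathrm{co}\,H}$. Assume that $B$ and $H$ are torsionfree $R$-modules, and suppose that there exist $R$-module decompositions $A=\bigoplus_{j\in J}A_j$ and $B=\bigoplus_{j\in J}B_j$ such that $B_j$ is finitely generated, $\phi(A_j)\subseteq B_j$, and $\lambda(B_j)\subseteq H\otimes_R B_j$ for all $j\in J$. Then $\overline{B}$ is a left comodule over the $k^\circ$-bialgebra $\overline{H}$, and $k\otimes_R B$ is a left comodule over the $k$-bialgebra $k\otimes_R H$ (with the structure maps induced from $\lambda$). If $\overline{B}^{\,\mathrm{co}\,\overline{H}}$ equals the image of the induced map $\overline{\phi}:\overline{A}\to\overline{B}$, then $[k\otimes_R B]^{\mathrm{co}\,k\otimes_R H}$ equals the image of the induced map $\mathrm{id}\otimes\phi:k\otimes_R A\to k\otimes_R B$.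
   Context: The field $k$ may have arbitrary characteristic and need not be algebraically closed. Since $q$ is transcendental over $k^\circ$, $R=k^\circ[q,q^{-1}]$ is a Laurent polynomial ring, and $k$ is an $R$-module via the inclusion $R\subset k$. Overbars denote reduction modulo $q-1$: for an $R$-module $A$, $\overline{A}=A/(q-1)A$, and for an $R$-module homomorphism $\phi:A\to B$, $\overline{\phi}:\overline{A}\to\overline{B}$ is the induced map; note $R/(q-1)R=k^\circ$. One identifies $\overline{H\otimes_R B}$ with $\overline{H}\otimes_{k^\circ}\overline{B}$ and $k\otimes_R(H\otimes_R B)$ with $(k\otimes_R H)\otimes_k(k\otimes_R B)$. For a left comodule $B$ over a bialgebra $H$ with structure map $\lambda:B\to H\otimes B$, the set of coinvariants is $B^{\mathrm{co}\,H}=\{b\in B\mid\lambda(b)=1\otimes b\}$. *)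

(* Defs.v *)
From HB Require Import structures.
From mathcomp Require Import all_boot all_algebra.
From mathcomp Require Import ring boolp classical_sets.

Set Implicit Arguments.
Unset Strict Implicit.
Unset Printing Implicit Defensive.

Import GRing.Theory.

Local Open Scope ring_scope.
Local Open Scope quotient_scope.

Section Tensor.
Variables (R : comNzRingType) (M N : lmodType R).

(* A list [:: (m1, n1); ...; (mr, nr)] stands for m1 ⊗ n1 + ... + mr ⊗ nr.
   Opposites need no generator: (- m, n) represents - (m ⊗ n). *)
Inductive tens_rel : seq (M * N) -> seq (M * N) -> Prop :=
| tens_rel_refl s : tens_rel s s
| tens_rel_sym s t : tens_rel s t -> tens_rel t s
| tens_rel_trans t s u : tens_rel s t -> tens_rel t u -> tens_rel s u
| tens_rel_cat s s' t t' :
    tens_rel s s' -> tens_rel t t' -> tens_rel (s ++ t) (s' ++ t')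
| tens_rel_catC s t : tens_rel (s ++ t) (t ++ s)
| tens_rel_0l n : tens_rel [:: (0, n)] [::]
| tens_rel_Dl m m' n : tens_rel [:: (m + m', n)] [:: (m, n); (m', n)]
| tens_rel_Dr m n n' : tens_rel [:: (m, n + n')] [:: (m, n); (m, n')]
| tens_rel_Z r m n : tens_rel [:: (r *: m, n)] [:: (m, r *: n)].

Definition tens_relb s t := `[< tens_rel s t >].

Lemma tens_equiv_class : equiv_class_of tens_relb.
Proof.
split=> [s|s t|t s u].
- exact/asboolP/tens_rel_refl.
- by apply: asbool_equiv_eq; split; apply: tens_rel_sym.
- by move=> /asboolP st /asboolP tu; apply/asboolP/(tens_rel_trans st).
Qed.

Canonical tens_equiv := EquivRelPack tens_equiv_class.
Canonical tens_encModRel := defaultEncModRel tens_relb.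

Definition tens : Type := {eq_quot tens_relb}.

HB.instance Definition _ := Choice.on tens.

Definition tens_of (s : seq (M * N)) : tens := \pi_({eq_quot tens_relb}) s.
Definition tens_repr (x : tens) : seq (M * N) :=
  repr (x : {eq_quot tens_relb}).

Lemma tens_reprK : cancel tens_repr tens_of.
Proof. exact: reprK. Qed.

Lemma tens_ofP s t : tens_rel s t -> tens_of s = tens_of t.
Proof. by move=> st; apply/eqmodP/asboolP. Qed.

Lemma tens_of_inj s t : tens_of s = tens_of t -> tens_rel s t.
Proof. by move/eqmodP/asboolP. Qed.

Lemma tens_reprP s : tens_rel (tens_repr (tens_of s)) s.
Proof. exact/tens_of_inj/tens_reprK. Qed.

Definition tens_add (x y : tens) := tens_of (tens_repr x ++ tens_repr y).
Definition tens_opp (x : tens) :=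
  tens_of [seq (- p.1, p.2) | p <- tens_repr x].
Definition tens_scale r (x : tens) :=
  tens_of [seq (r *: p.1, p.2) | p <- tens_repr x].

Lemma tens_add_of s t : tens_add (tens_of s) (tens_of t) = tens_of (s ++ t).
Proof. by apply: tens_ofP; apply: tens_rel_cat; apply: tens_reprP. Qed.

Lemma tens_scale_of r s :
  tens_scale r (tens_of s) = tens_of [seq (r *: p.1, p.2) | p <- s].
Proof.
apply: tens_ofP; move: (tens_reprP s); move: (tens_repr _) => t.
elim=> {s t} /=.
- by move=> s; apply: tens_rel_refl.
- by move=> s t _; apply: tens_rel_sym.
- by move=> t s u _ + _; apply: tens_rel_trans.
- by move=> s s' t t' _ IHs _ IHt; rewrite !map_cat; apply: tens_rel_cat.
- by move=> s t; rewrite !map_cat; apply: tens_rel_catC.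
- by move=> n; rewrite scaler0; apply: tens_rel_0l.
- by move=> m m' n; rewrite scalerDr; apply: tens_rel_Dl.
- by move=> m n n'; apply: tens_rel_Dr.
- by move=> r' m n; rewrite scalerA mulrC -scalerA; apply: tens_rel_Z.
Qed.

Lemma tens_addA : associative tens_add.
Proof.
move=> x y z; rewrite -[x]tens_reprK -[y]tens_reprK -[z]tens_reprK.
by rewrite !tens_add_of catA.
Qed.

Lemma tens_addC : commutative tens_add.
Proof.
move=> x y; rewrite -[x]tens_reprK -[y]tens_reprK !tens_add_of.
exact/tens_ofP/tens_rel_catC.
Qed.

Lemma tens_add0 : left_id (tens_of [::]) tens_add.
Proof. by move=> x; rewrite -[x]tens_reprK tens_add_of. Qed.

Lemma tens_addN : left_inverse (tens_of [::]) tens_opp tens_add.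
Proof.
move=> x; have -> : tens_opp x = tens_scale (-1) x.
  by congr tens_of; apply: eq_map => p; congr pair; rewrite scaleN1r.
rewrite -[x]tens_reprK tens_scale_of.
elim: (tens_repr x) => [|[m n] s IHs] /=; first by rewrite tens_add_of.
rewrite scaleN1r -cat1s -[(m, n) :: s]cat1s -!tens_add_of.
rewrite tens_addA (tens_addC (tens_add _ _) (tens_of [:: (m, n)])) !tens_addA.
rewrite -tens_addA IHs tens_addC tens_add0 tens_add_of.
apply: tens_ofP; apply: tens_rel_trans (tens_rel_0l n).
by rewrite -(subrr m); apply/tens_rel_sym/tens_rel_Dl.
Qed.

HB.instance Definition _ :=
  GRing.isZmodule.Build tens tens_addA tens_addC tens_add0 tens_addN.

Lemma tens_ofD s t : tens_of (s ++ t) = tens_of s + tens_of t.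
Proof. by rewrite -tens_add_of. Qed.

Lemma tens_scaleA a b x : tens_scale a (tens_scale b x) = tens_scale (a * b) x.
Proof.
rewrite -[x]tens_reprK !tens_scale_of -map_comp; congr tens_of.
by apply: eq_map => p /=; rewrite scalerA.
Qed.

Lemma tens_scale1 : left_id 1 tens_scale.
Proof.
move=> x; rewrite -[x]tens_reprK tens_scale_of; congr tens_of.
by rewrite -[RHS]map_id; apply: eq_map => -[m n] /=; rewrite scale1r.
Qed.

Lemma tens_scaleDr : right_distributive tens_scale +%R.
Proof.
move=> a x y; rewrite -[x]tens_reprK -[y]tens_reprK -tens_ofD !tens_scale_of.
by rewrite map_cat tens_ofD.
Qed.

Lemma tens_scaleDl x : {morph tens_scale^~ x : a b / a + b}.
Proof.
move=> a b; rewrite -[x]tens_reprK !tens_scale_of.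
elim: (tens_repr x) => [|[m n] s IHs] /=; first by rewrite -tens_ofD.
rewrite -cat1s -[_ :: map _ _]cat1s -[X in _ + tens_of X]cat1s !tens_ofD IHs.
rewrite addrACA; congr (_ + _).
by rewrite -tens_ofD scalerDl; apply/tens_ofP/tens_rel_Dl.
Qed.

HB.instance Definition _ := GRing.Zmodule_isLmodule.Build R tens
  tens_scaleA tens_scale1 tens_scaleDr tens_scaleDl.

Definition tpure (m : M) (n : N) : tens := tens_of [:: (m, n)].

Lemma tpureDl m m' n : tpure (m + m') n = tpure m n + tpure m' n.
Proof. by rewrite -tens_ofD; apply/tens_ofP/tens_rel_Dl. Qed.

Lemma tpureDr m n n' : tpure m (n + n') = tpure m n + tpure m n'.
Proof. by rewrite -tens_ofD; apply/tens_ofP/tens_rel_Dr. Qed.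

Lemma tpureZl r m n : tpure (r *: m) n = r *: tpure m n.
Proof. by rewrite [RHS]tens_scale_of. Qed.

Lemma tpureZr r m n : tpure m (r *: n) = r *: tpure m n.
Proof. by rewrite -tpureZl; apply/esym/tens_ofP/tens_rel_Z. Qed.

Lemma tpure0l n : tpure 0 n = 0.
Proof. by apply: (@addrI _ (tpure 0 n)); rewrite -tpureDl !addr0. Qed.

Lemma tpure0r m : tpure m 0 = 0.
Proof. by apply: (@addrI _ (tpure m 0)); rewrite -tpureDr !addr0. Qed.

Lemma tens_sum (x : tens) : x = \sum_(p <- tens_repr x) tpure p.1 p.2.
Proof.
rewrite -{1}[x]tens_reprK; elim: (tens_repr x) => [|[m n] s IHs]; first by rewrite big_nil.
by rewrite big_cons -cat1s tens_ofD IHs.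
Qed.

Lemma tens_ind (P : tens -> Prop) :
  P 0 -> (forall m n x, P x -> P (tpure m n + x)) -> forall x, P x.
Proof.
move=> P0 PD x; rewrite [x]tens_sum.
by elim: (tens_repr x) => [|p s IHs]; rewrite ?big_nil ?big_cons //; apply: PD.
Qed.

Section Lift.
Variable G : zmodType.

Definition balanced (f : M -> N -> G) :=
  [/\ forall m m' n, f (m + m') n = f m n + f m' n,
      forall m n n', f m (n + n') = f m n + f m n'
    & forall r m n, f (r *: m) n = f m (r *: n)].

(* This is independent of the representative when f is balanced,
   see tliftE and tlift_unique. *)
Definition tlift (f : M -> N -> G) (x : tens) : G :=
  \sum_(p <- tens_repr x) f p.1 p.2.

Lemma tlift_of f s : balanced f ->
  tlift f (tens_of s) = \sum_(p <- s) f p.1 p.2.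
Proof.
case=> fDl fDr fZ; rewrite /tlift.
move: (tens_reprP s); move: (tens_repr _) => t; elim=> {s t} //=.
- by move=> s t u _ -> _ ->.
- by move=> s s' t t' _ IHs _ IHt; rewrite !big_cat /= IHs IHt.
- by move=> s t; rewrite !big_cat /= addrC.
- move=> n; rewrite big_seq1 big_nil; apply: (@addrI _ (f 0 n)).
  by rewrite -fDl !addr0.
- by move=> m m' n; rewrite !big_cons !big_nil !addr0 fDl.
- by move=> m n n'; rewrite !big_cons !big_nil !addr0 fDr.
- by move=> r m n; rewrite !big_seq1 fZ.
Qed.

Lemma tliftE f m n : balanced f -> tlift f (tpure m n) = f m n.
Proof. by move=> fP; rewrite tlift_of // big_seq1. Qed.

Lemma tliftD f x y : balanced f -> tlift f (x + y) = tlift f x + tlift f y.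
Proof.
by move=> fP; rewrite -[x]tens_reprK -[y]tens_reprK -tens_ofD !tlift_of // big_cat.
Qed.

Lemma tlift0 f : balanced f -> tlift f 0 = 0.
Proof. by move=> fP; apply: (@addrI _ (tlift f 0)); rewrite -tliftD // !addr0. Qed.

Lemma tlift_unique f (g : tens -> G) : balanced f ->
    {morph g : x y / x + y} -> (forall m n, g (tpure m n) = f m n) ->
  forall x, g x = tlift f x.
Proof.
move=> fP gD gE; elim/tens_ind => [|m n x IHx].
  by rewrite tlift0 //; apply: (@addrI _ (g 0)); rewrite -gD !addr0.
by rewrite gD tliftD // gE tliftE // IHx.
Qed.

End Lift.
End Tensor.

Section TensorMap.
Variables (R S : comNzRingType) (M N : lmodType R) (M' N' : lmodType S).

(* f ⊗ g, for R-linear maps (S = R) or, more generally, for maps that are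
   semilinear over a ring morphism R -> S. *)
Definition tmap (f : M -> M') (g : N -> N') : tens M N -> tens M' N' :=
  tlift (fun m n => tpure (f m) (g n)).

Variables (sigma : {rmorphism R -> S}) (f : M -> M') (g : N -> N').
Hypotheses (fP : linear_for (sigma \; *:%R) f).
Hypotheses (gP : linear_for (sigma \; *:%R) g).

Lemma semilinearD (U : lmodType R) (V : lmodType S) (h : U -> V) :
  linear_for (sigma \; *:%R) h -> {morph h : x y / x + y}.
Proof. by move=> hP x y; rewrite -{1}[x]scale1r hP /= rmorph1 scale1r. Qed.

Lemma semilinear0 (U : lmodType R) (V : lmodType S) (h : U -> V) :
  linear_for (sigma \; *:%R) h -> h 0 = 0.
Proof. by move=> hP; apply: (@addrI _ (h 0)); rewrite -semilinearD // !addr0. Qed.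

Lemma semilinearZ (U : lmodType R) (V : lmodType S) (h : U -> V) :
  linear_for (sigma \; *:%R) h -> forall a x, h (a *: x) = sigma a *: h x.
Proof. by move=> hP a x; rewrite -[a *: x]addr0 hP semilinear0 // addr0. Qed.

Lemma tmap_balanced : balanced (fun m n => tpure (f m) (g n)).
Proof.
split=> [m m' n|m n n'|r m n].
- by rewrite semilinearD // tpureDl.
- by rewrite semilinearD // tpureDr.
- by rewrite !semilinearZ // tpureZl tpureZr.
Qed.

Lemma tmapE m n : tmap f g (tpure m n) = tpure (f m) (g n).
Proof. exact: tliftE tmap_balanced. Qed.

Lemma tmap_semilinear : linear_for (sigma \; *:%R) (tmap f g).
Proof.
have bal := tmap_balanced.
move=> a x y; rewrite /tmap tliftD //=; congr (_ + _).
elim/tens_ind: x => [|m n x IHx]; first by rewrite scaler0 tlift0 // scaler0.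
rewrite scalerDr -tpureZl !tliftD // IHx scalerDr; congr (_ + _).
by rewrite !tliftE // semilinearZ // tpureZl.
Qed.

End TensorMap.

Section Canonical.
Variable R : comNzRingType.

Lemma linear_balanced (M N P : lmodType R) (f : M -> N -> P) :
  (forall n, linear (f^~ n)) -> (forall m, linear (f m)) -> balanced f.
Proof.
move=> fl fr.
have f0l n : f 0 n = 0.
  by have := fl n (-1) 0 0; rewrite scaler0 addr0 scaleN1r addNr.
have f0r m : f m 0 = 0.
  by have := fr m (-1) 0 0; rewrite scaler0 addr0 scaleN1r addNr.
split=> [m m' n|m n n'|r m n].
- by have := fl n 1 m m'; rewrite !scale1r.
- by have := fr m 1 n n'; rewrite !scale1r.
- have := fl n r m 0; have := fr m r n 0.
  by rewrite !addr0 f0l f0r !addr0 => -> ->.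
Qed.

Lemma tlift_linear (M N P : lmodType R) (f : M -> N -> P) :
    (forall n, linear (f^~ n)) -> (forall m, linear (f m)) ->
  linear (tlift f).
Proof.
move=> fl fr a x y; have fP := linear_balanced fl fr.
rewrite tliftD //; congr (_ + _); elim/tens_ind: x => [|m n x IHx].
  by rewrite scaler0 tlift0 // scaler0.
rewrite scalerDr !tliftD // IHx scalerDr -tpureZl !tliftE //; congr (_ + _).
have f0 : f 0 n = 0.
  by have := fl n (-1) 0 0; rewrite scaler0 addr0 scaleN1r addNr.
by have := fl n a m 0; rewrite !addr0 f0 addr0.
Qed.

Lemma tpure_linearl (M N : lmodType R) (n : N) : linear ((@tpure R M N)^~ n).
Proof. by move=> a x y; rewrite tpureDl tpureZl. Qed.

Lemma tpure_linearr (M N : lmodType R) (m : M) : linear (@tpure R M N m).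
Proof. by move=> a x y; rewrite tpureDr tpureZr. Qed.

Definition tassoc (M N P : lmodType R) : tens (tens M N) P -> tens M (tens N P) :=
  tlift (fun x p => tlift (fun m n => tpure m (tpure n p)) x).

Lemma tassocE (M N P : lmodType R) (m : M) (n : N) (p : P) :
  tassoc (tpure (tpure m n) p) = tpure m (tpure n p).
Proof.
have bal (p' : P) : balanced (fun (m : M) (n : N) => tpure m (tpure n p')).
  by apply: linear_balanced => ? a x y; rewrite tpure_linearl ?tpure_linearr.
rewrite /tassoc tliftE ?tliftE //.
apply: linear_balanced => [p'|x] a y z.
  by apply: tlift_linear => ? b u v; rewrite ?tpure_linearl ?tpure_linearr.
elim/tens_ind: x => [|m' n' x IHx].
  by rewrite !tlift0 // scaler0 addr0.
by rewrite !tliftD // IHx !tliftE // !tpure_linearr scalerDr addrACA.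
Qed.

(* The canonical isomorphisms R ⊗ M -> M and M ⊗ R -> M. *)
Definition tlid (M : lmodType R) : tens R^o M -> M :=
  tlift (fun (r : R^o) m => r *: m).
Definition trid (M : lmodType R) : tens M R^o -> M :=
  tlift (fun m (r : R^o) => r *: m).

Lemma tassoc_linear (M N P : lmodType R) : linear (@tassoc M N P).
Proof.
have lin (p : P) : linear (tlift (fun (m : M) (n : N) => tpure m (tpure n p))).
  by apply: tlift_linear => ? a x y; rewrite tpure_linearl ?tpure_linearr.
apply: tlift_linear => [p|x]; first exact: lin.
have bal p := linear_balanced
  (fun n => @tpure_linearl M _ (@tpure R N P n p))
  (fun m => fun a x y => etrans (congr1 (tpure m) (@tpure_linearl N P p a x y))
                                (tpure_linearr m a _ _)).
move=> a p p'; elim/tens_ind: x => [|m n x IHx].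
  by rewrite !tlift0 // scaler0 addr0.
by rewrite !tliftD // IHx !tliftE // !tpure_linearr scalerDr addrACA.
Qed.

HB.instance Definition _ (M N P : lmodType R) :=
  GRing.isLinear.Build R _ _ _ (@tassoc M N P) (@tassoc_linear M N P).

Lemma tlid_lin (M : lmodType R) :
  (forall m : M, linear (fun r : R^o => r *: m)) /\
  (forall r : R^o, linear (fun m : M => r *: m)).
Proof.
split=> [m a x y|r a x y]; first by rewrite scalerDl -scalerA.
by rewrite scalerDr !scalerA mulrC.
Qed.

Lemma tlid_linear (M : lmodType R) : linear (@tlid M).
Proof. by apply: tlift_linear; case: (tlid_lin M). Qed.

Lemma trid_linear (M : lmodType R) : linear (@trid M).
Proof. by apply: tlift_linear; case: (tlid_lin M). Qed.

HB.instance Definition _ (M : lmodType R) :=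
  GRing.isLinear.Build R _ _ _ (@tlid M) (@tlid_linear M).
HB.instance Definition _ (M : lmodType R) :=
  GRing.isLinear.Build R _ _ _ (@trid M) (@trid_linear M).

Lemma tlidE (M : lmodType R) (r : R^o) (m : M) : tlid (tpure r m) = r *: m.
Proof. by apply: tliftE; apply: linear_balanced; case: (tlid_lin M). Qed.

Lemma tridE (M : lmodType R) (m : M) (r : R^o) : trid (tpure m r) = r *: m.
Proof. by apply: tliftE; apply: linear_balanced; case: (tlid_lin M). Qed.

Section TensorMapLinear.
Variables (M N M' N' : lmodType R).
Variables (f : {linear M -> M'}) (g : {linear N -> N'}).

Lemma tmap_linear : linear (tmap f g).
Proof. by apply: (@tmap_semilinear _ _ _ _ _ _ idfun); apply: linearP. Qed.

HB.instance Definition _ := GRing.isLinear.Build R _ _ _ (tmap f g) tmap_linear.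

Lemma tmap_linE m n : tmap f g (tpure m n) = tpure (f m) (g n).
Proof. by apply: (@tmapE _ _ _ _ _ _ idfun); apply: linearP. Qed.

End TensorMapLinear.

Section TensorAlgebra.
Variables A B : algType R.

Definition tens_one : tens A B := tpure 1 1.
Definition tens_mul (x y : tens A B) : tens A B :=
  tlift (fun a b => tlift (fun a' b' => tpure (a * a') (b * b')) y) x.

Lemma tens_mul_bal a b :
  balanced (fun (a' : A) (b' : B) => tpure (a * a') (b * b')).
Proof.
apply: linear_balanced => ? r x y.
  by rewrite mulrDr -scalerAr tpure_linearl.
by rewrite mulrDr -scalerAr tpure_linearr.
Qed.

Lemma tens_mul_linl y :
  (forall b, linear (fun a : A =>
     tlift (fun (a' : A) (b' : B) => tpure (a * a') (b * b')) y)) /\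
  (forall a, linear (fun b : B =>
     tlift (fun (a' : A) (b' : B) => tpure (a * a') (b * b')) y)).
Proof.
split=> c r u v.
  elim/tens_ind: y => [|a b y IHy].
    by rewrite !tlift0 ?scaler0 ?addr0 //; apply: tens_mul_bal.
  rewrite !tliftD ?IHy ?tliftE; try exact: tens_mul_bal.
  by rewrite mulrDl -scalerAl tpure_linearl scalerDr addrACA.
elim/tens_ind: y => [|a b y IHy].
  by rewrite !tlift0 ?scaler0 ?addr0 //; apply: tens_mul_bal.
rewrite !tliftD ?IHy ?tliftE; try exact: tens_mul_bal.
by rewrite mulrDl -scalerAl tpure_linearr scalerDr addrACA.
Qed.

Lemma tens_mul_linear_l y : linear (tens_mul^~ y).
Proof. by apply: tlift_linear; case: (tens_mul_linl y). Qed.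

Lemma tens_mul_linear_r x : linear (tens_mul x).
Proof.
have bal y := linear_balanced (tens_mul_linl y).1 (tens_mul_linl y).2.
move=> r y z; rewrite /tens_mul; elim/tens_ind: x => [|a b x IHx].
  by rewrite !tlift0 // scaler0 addr0.
rewrite !tliftD // !tliftE // IHx scalerDr addrACA; congr (_ + _).
by apply: tlift_linear => ? s u v; rewrite mulrDr -scalerAr ?tpure_linearl
  ?tpure_linearr.
Qed.

Lemma tens_mulE a b a' b' :
  tens_mul (tpure a b) (tpure a' b') = tpure (a * a') (b * b').
Proof.
rewrite /tens_mul !tliftE //; first exact: tens_mul_bal.
by apply: linear_balanced; case: (tens_mul_linl (tpure a' b')).
Qed.

Lemma tens_mulDl : left_distributive tens_mul +%R.
Proof. by move=> x y z; have := tens_mul_linear_l z 1 x y; rewrite !scale1r. Qed.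
Lemma tens_mulDr : right_distributive tens_mul +%R.
Proof. by move=> x y z; have := tens_mul_linear_r x 1 y z; rewrite !scale1r. Qed.
Lemma tens_mul0l x : tens_mul 0 x = 0.
Proof. by apply: (@addrI _ (tens_mul 0 x)); rewrite -tens_mulDl !addr0. Qed.
Lemma tens_mul0r x : tens_mul x 0 = 0.
Proof. by apply: (@addrI _ (tens_mul x 0)); rewrite -tens_mulDr !addr0. Qed.

Lemma tens_mulA : associative tens_mul.
Proof.
move=> x y z; elim/tens_ind: x => [|a b x IHx]; first by rewrite !tens_mul0l.
rewrite !tens_mulDl {}IHx; congr (_ + _).
elim/tens_ind: y => [|a' b' y IHy].
  by rewrite !(tens_mul0l, tens_mul0r).
rewrite tens_mulDl !tens_mulDr tens_mulDl {}IHy; congr (_ + _).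
elim/tens_ind: z => [|a'' b'' z IHz]; first by rewrite !tens_mul0r.
by rewrite !tens_mulDr IHz !tens_mulE !mulrA.
Qed.

Lemma tens_mul1 : left_id tens_one tens_mul.
Proof.
elim/tens_ind => [|a b x IHx]; first by rewrite tens_mul0r.
by rewrite tens_mulDr IHx tens_mulE !mul1r.
Qed.

Lemma tens_mulr1 : right_id tens_one tens_mul.
Proof.
elim/tens_ind => [|a b x IHx]; first by rewrite tens_mul0l.
by rewrite tens_mulDl IHx tens_mulE !mulr1.
Qed.

HB.instance Definition _ := GRing.Zmodule_isPzRing.Build (tens A B)
  tens_mulA tens_mul1 tens_mulr1 tens_mulDl tens_mulDr.

End TensorAlgebra.
End Canonical.

HB.mixin Record isBialgebra (R : comNzRingType) H of GRing.Algebra R H := {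
  comul : {linear H -> tens H H};
  counit : {linear H -> R^o};
  comulA : forall h,
    tassoc (tmap comul idfun (comul h)) = tmap idfun comul (comul h);
  counitl : forall h, tlid (tmap counit idfun (comul h)) = h;
  counitr : forall h, trid (tmap idfun counit (comul h)) = h;
  comul_monoid_morphism : monoid_morphism comul;
  counit_monoid_morphism : monoid_morphism counit
}.

#[short(type="bialgType")]
HB.structure Definition Bialgebra (R : comNzRingType) :=
  {H of GRing.Algebra R H & isBialgebra R H}.

Definition is_comodule (R : comNzRingType) (H : bialgType R) (B : lmodType R)
    (lam : {linear B -> tens H B}) : Prop :=
  (forall b, tassoc (tmap comul idfun (lam b)) = tmap idfun lam (lam b)) /\
  (forall b, tlid (tmap counit idfun (lam b)) = b).

Definition coinv (R : comNzRingType) (H : bialgType R) (B : lmodType R)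
    (lam : {linear B -> tens H B}) : set B :=
  [set b | lam b = tpure 1 b]%classic.

(* A bialgebra structure on H' determined by a semilinear ring morphism
   pi : H -> H' whose image generates H' as a module. *)
Section Transport.
Variables (R S : comNzRingType) (sigma : {rmorphism R -> S}).
Variables (H : bialgType R) (H' : algType S) (pi : H -> H').
Hypothesis piP : linear_for (sigma \; *:%R) pi.
Hypothesis piM : monoid_morphism pi.
Hypothesis pi_gen : forall P : H' -> Prop, P 0 ->
  (forall a h x, P x -> P (a *: pi h + x)) -> forall x, P x.
Variables (comul' : {linear H' -> tens H' H'}) (counit' : {linear H' -> S^o}).
Hypothesis comul'E : forall h, comul' (pi h) = tmap pi pi (comul h).
Hypothesis counit'E : forall h, counit' (pi h) = sigma (counit h).

Lemma transport_linear_eq (V : lmodType S) (f g : H' -> V) :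
  linear f -> linear g -> (forall h, f (pi h) = g (pi h)) -> f =1 g.
Proof.
move=> fP gP fg; apply: pi_gen => [|a h x fgx]; last by rewrite fP gP fg fgx.
have f0 (e : H' -> V) : linear e -> e 0 = 0.
  by move=> eP; have := eP (-1) 0 0; rewrite scaler0 addr0 scaleN1r addNr.
by rewrite !f0.
Qed.


Let piD := semilinearD piP.
Let pi0 := semilinear0 piP.
Let piZ := semilinearZ piP.
Let ppP := tmap_semilinear piP piP.
Let ppE := tmapE piP piP.
Let pppP := tmap_semilinear piP ppP.

Let pD := semilinearD ppP.
Let p0 := semilinear0 ppP.
Let ppD := semilinearD pppP.
Let pp0 := semilinear0 pppP.

Lemma transport_tassoc (x : tens (tens H H) H) :
  tassoc (tmap (tmap pi pi) pi x) = tmap pi (tmap pi pi) (tassoc x).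
Proof.
have qP := tmap_semilinear ppP piP.
elim/tens_ind: x => [|y p x IHx].
  by rewrite (semilinear0 qP) !linear0 pp0.
rewrite (semilinearD qP) !linearD ppD /= IHx; congr (_ + _).
rewrite (tmapE ppP piP); elim/tens_ind: y => [|m n y IHy].
  by rewrite p0 !tpure0l !linear0 pp0.
rewrite pD !tpureDl !linearD ppD /= IHy; congr (_ + _).
by rewrite ppE !tassocE (tmapE piP ppP) ppE.
Qed.

Lemma transport_comull (x : tens H H) :
  tmap comul' idfun (tmap pi pi x) = tmap (tmap pi pi) pi (tmap comul idfun x).
Proof.
have qP := tmap_semilinear ppP piP.
elim/tens_ind: x => [|m n x IHx].
  by rewrite p0 !linear0 (semilinear0 qP).
rewrite pD !linearD (semilinearD qP) /= IHx; congr (_ + _).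
by rewrite ppE !tmap_linE (tmapE ppP piP) comul'E.
Qed.

Lemma transport_comulr (x : tens H H) :
  tmap idfun comul' (tmap pi pi x) = tmap pi (tmap pi pi) (tmap idfun comul x).
Proof.
elim/tens_ind: x => [|m n x IHx]; first by rewrite p0 !linear0 pp0.
rewrite pD !linearD ppD /= IHx; congr (_ + _).
by rewrite ppE !tmap_linE (tmapE piP ppP) comul'E.
Qed.

Lemma transport_comulA h :
  tassoc (tmap comul' idfun (comul' h)) = tmap idfun comul' (comul' h).
Proof.
move: h; apply: transport_linear_eq => [||h].
- exact: (linearP (@tassoc _ _ _ _ \o tmap comul' idfun \o comul')).
- exact: (linearP (tmap idfun comul' \o comul')).
- by rewrite comul'E transport_comull transport_tassoc comulA transport_comulr.
Qed.

Lemma transport_counitl h : tlid (tmap counit' idfun (comul' h)) = h.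
Proof.
move: h; apply: transport_linear_eq => [||h].
- exact: (linearP (@tlid _ _ \o tmap counit' idfun \o comul')).
- by [].
rewrite comul'E -[in RHS](counitl h).
elim/tens_ind: (comul h) => [|m n x IHx].
  by rewrite p0 !linear0 pi0.
rewrite pD !linearD piD /= IHx; congr (_ + _).
by rewrite ppE !tmap_linE !tlidE counit'E piZ.
Qed.

Lemma transport_counitr h : trid (tmap idfun counit' (comul' h)) = h.
Proof.
move: h; apply: transport_linear_eq => [||h].
- exact: (linearP (@trid _ _ \o tmap idfun counit' \o comul')).
- by [].
rewrite comul'E -[in RHS](counitr h).
elim/tens_ind: (comul h) => [|m n x IHx].
  by rewrite p0 !linear0 pi0.
rewrite pD !linearD piD /= IHx; congr (_ + _).
by rewrite ppE !tmap_linE !tridE counit'E piZ.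
Qed.

Lemma tmap_monoid : monoid_morphism (tmap pi pi : tens H H -> tens H' H').
Proof.
split=> [|x y]; first by rewrite [LHS]ppE !piM.1.
elim/tens_ind: x => [|a b x IHx]; first by rewrite mul0r p0 mul0r.
rewrite mulrDl !pD mulrDl {}IHx; congr (_ + _).
elim/tens_ind: y => [|c d y IHy]; first by rewrite mulr0 p0 mulr0.
rewrite mulrDr !pD mulrDr {}IHy; congr (_ + _).
rewrite -[tpure a b * _]/(tens_mul _ _) tens_mulE !ppE !piM.2.
by rewrite -[RHS]/(tens_mul _ _) tens_mulE.
Qed.

Lemma linear_eq0 (V W : lmodType S) (f : V -> W) : linear f -> f 0 = 0.
Proof.
by move=> fP; have := fP (-1) 0 0; rewrite scaler0 addr0 scaleN1r addNr.
Qed.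

Lemma transport_comulM : monoid_morphism comul'.
Proof.
split=> [|x y].
  by rewrite -piM.1 comul'E comul_monoid_morphism.1 tmap_monoid.1.
move: x; apply: transport_linear_eq => [a u v|a u v|h].
- by rewrite mulrDl -scalerAl linearP.
- by rewrite linearP; apply: tens_mul_linear_l.
move: y; apply: transport_linear_eq => [a u v|a u v|g].
- by rewrite mulrDr -scalerAr linearP.
- by rewrite linearP; apply: tens_mul_linear_r.
by rewrite -piM.2 !comul'E comul_monoid_morphism.2 tmap_monoid.2.
Qed.

Lemma transport_counitM : monoid_morphism counit'.
Proof.
split=> [|x y].
  by rewrite -piM.1 counit'E counit_monoid_morphism.1 rmorph1.
move: x; apply: transport_linear_eq => [a u v|a u v|h].
- by rewrite mulrDl -scalerAl linearP.
- by rewrite linearP mulrDl -scalerAl.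
move: y; apply: transport_linear_eq => [a u v|a u v|g].
- by rewrite mulrDr -scalerAr linearP.
- by rewrite linearP mulrDr; congr (_ + _); rewrite /GRing.scale /= mulrCA.
by rewrite -piM.2 !counit'E counit_monoid_morphism.2 rmorphM.
Qed.

End Transport.

Section BaseChange.
Variables (R S : comNzRingType) (sigma : {rmorphism R -> S}).

(* S as an R-algebra through sigma. *)
Definition restr of {rmorphism R -> S} : Type := S.
Local Notation Ss := (restr sigma).

HB.instance Definition _ := GRing.ComNzRing.copy Ss S.

Definition restr_scale (r : R) (c : Ss) : Ss := sigma r * c.

Lemma restr_scaleA a b c : restr_scale a (restr_scale b c) = restr_scale (a * b) c.
Proof. by rewrite /restr_scale rmorphM mulrA. Qed.
Lemma restr_scale1 : left_id 1 restr_scale.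
Proof. by move=> c; rewrite /restr_scale rmorph1 mul1r. Qed.
Lemma restr_scaleDr : right_distributive restr_scale +%R.
Proof. by move=> a x y; apply: mulrDr. Qed.
Lemma restr_scaleDl v : {morph restr_scale^~ v : a b / a + b}.
Proof. by move=> a b; rewrite /restr_scale rmorphD mulrDl. Qed.

HB.instance Definition _ := GRing.Zmodule_isLmodule.Build R Ss
  restr_scaleA restr_scale1 restr_scaleDr restr_scaleDl.

Lemma restr_scaleAl a (u v : Ss) : a *: (u * v) = (a *: u) * v.
Proof. exact: mulrA. Qed.
HB.instance Definition _ := GRing.Lmodule_isLalgebra.Build R Ss restr_scaleAl.
Lemma restr_scaleAr a (u v : Ss) : a *: (u * v) = u * (a *: v).
Proof. exact: mulrCA. Qed.
HB.instance Definition _ := GRing.Lalgebra_isAlgebra.Build R Ss restr_scaleAr.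

Section Module.
Variable M : lmodType R.

Definition ext (M : lmodType R) : Type := tens Ss M.
HB.instance Definition _ := GRing.Zmodule.copy (ext M) (tens Ss M).

Definition ext_in (m : M) : ext M := tpure (1 : Ss) m.

Definition ext_scale (a : S) (x : ext M) : ext M :=
  tmap (fun c : Ss => (a * c : Ss)) (idfun : M -> M) x.

Lemma mul_linear a : linear (fun c : Ss => (a * c : Ss)).
Proof. by move=> r c d; rewrite mulrDr scalerAr. Qed.

Lemma ext_scale_linear a : linear (ext_scale a : tens Ss M -> tens Ss M).
Proof.
apply: (@tmap_semilinear _ _ _ _ _ _ idfun); [exact: mul_linear | by []].
Qed.

Lemma ext_scaleE a c m : ext_scale a (tpure (c : Ss) m) = tpure (a * c : Ss) m.
Proof. by apply: (@tmapE _ _ _ _ _ _ idfun); [exact: mul_linear|]. Qed.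

Lemma ext_scaleDr : right_distributive ext_scale +%R.
Proof.
by move=> a x y; have := ext_scale_linear a 1 x y; rewrite !scale1r.
Qed.

Lemma ext_scaler0 a : ext_scale a 0 = 0.
Proof. by apply: (@addrI _ (ext_scale a 0)); rewrite -ext_scaleDr !addr0. Qed.

Lemma ext_scaleA a b x : ext_scale a (ext_scale b x) = ext_scale (a * b) x.
Proof.
elim/tens_ind: x => [|c m x IHx]; first by rewrite !ext_scaler0.
by rewrite !ext_scaleDr IHx !ext_scaleE mulrA.
Qed.

Lemma ext_scale1 : left_id 1 ext_scale.
Proof.
elim/tens_ind => [|c m x IHx]; first by rewrite ext_scaler0.
by rewrite ext_scaleDr IHx ext_scaleE mul1r.
Qed.

Lemma ext_scaleDl x : {morph ext_scale^~ x : a b / a + b}.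
Proof.
move=> a b; elim/tens_ind: x => [|c m x IHx].
  by rewrite !ext_scaler0 addr0.
by rewrite !ext_scaleDr IHx !ext_scaleE mulrDl tpureDl addrACA.
Qed.

HB.instance Definition _ := GRing.Zmodule_isLmodule.Build S (ext M)
  ext_scaleA ext_scale1 ext_scaleDr ext_scaleDl.

Lemma ext_scalepE (a : S) (c : Ss) m :
  a *: (tpure c m : ext M) = tpure (a * c : Ss) m.
Proof. exact: ext_scaleE. Qed.

Lemma ext_in_semilinear : linear_for (sigma \; *:%R) ext_in.
Proof.
move=> r x y; rewrite /ext_in tpureDr tpureZr -tpureZl; congr (_ + _).
by rewrite /= ext_scalepE.
Qed.

Lemma ext_ind (P : ext M -> Prop) :
  P 0 -> (forall a m x, P x -> P (a *: ext_in m + x)) -> forall x, P x.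
Proof.
move=> P0 PD; apply: tens_ind => // c m x Px.
by have := PD c m x Px; rewrite ext_scalepE mulr1.
Qed.

Section Lift.
Variable V : lmodType S.

(* c ⊗ m |-> c f(m), for f semilinear *)
Definition ext_lift (f : M -> V) : ext M -> V :=
  tlift (fun (c : Ss) m => (c : S) *: f m).

Variable f : M -> V.
Hypothesis fP : linear_for (sigma \; *:%R) f.

Lemma ext_lift_balanced : balanced (fun (c : Ss) m => (c : S) *: f m).
Proof.
split=> [c d m|c m n|r c m]; first by rewrite scalerDl.
  by rewrite (semilinearD fP) scalerDr.
by rewrite (semilinearZ fP) !scalerA mulrC.
Qed.

Lemma ext_lift_in m : ext_lift f (ext_in m) = f m.
Proof. by rewrite [LHS](tliftE _ _ ext_lift_balanced) scale1r. Qed.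

Lemma ext_lift_linear : linear (ext_lift f).
Proof.
have bal := ext_lift_balanced.
move=> a x y; rewrite [LHS](tliftD _ _ bal); congr (_ + _).
elim/tens_ind: x => [|c m x IHx].
  by rewrite scaler0 [LHS](tlift0 bal) [ext_lift _ _](tlift0 bal) scaler0.
rewrite scalerDr [LHS](tliftD _ _ bal) IHx [ext_lift _ (_ + _)](tliftD _ _ bal).
rewrite scalerDr; congr (_ + _).
by rewrite ext_scalepE !(tliftE _ _ bal) scalerA.
Qed.

End Lift.
End Module.

Definition ext_map (A B : lmodType R) (phi : A -> B) : ext A -> ext B :=
  tmap (idfun : Ss -> Ss) phi.

Section MapLinear.
Variables (A B : lmodType R) (phi : {linear A -> B}).

Lemma ext_mapE (c : Ss) a : ext_map phi (tpure c a) = tpure c (phi a).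
Proof. exact: (@tmap_linE R Ss A Ss B idfun phi). Qed.

Lemma ext_map_linear : linear (ext_map phi).
Proof.
have pD x y : ext_map phi (x + y) = ext_map phi x + ext_map phi y.
  exact: (linearD (tmap (idfun : Ss -> Ss) phi)).
have p0 : ext_map phi 0 = 0 by exact: (linear0 (tmap (idfun : Ss -> Ss) phi)).
move=> s x y; rewrite pD; congr (_ + _).
elim/tens_ind: x => [|c a x IHx]; first by rewrite scaler0 p0 scaler0.
by rewrite scalerDr !pD IHx scalerDr ext_scalepE !ext_mapE ext_scalepE.
Qed.

HB.instance Definition _ :=
  GRing.isLinear.Build S _ _ _ (ext_map phi) ext_map_linear.

End MapLinear.

(* S ⊗ B -> S ⊗ (H ⊗ B) = (S ⊗ H) ⊗_S (S ⊗ B) *)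
Definition ext_coact (H B : lmodType R) (lam : B -> tens H B) :
    ext B -> tens (ext H) (ext B) :=
  ext_lift (fun b => tmap (@ext_in H) (@ext_in B) (lam b)).

Section CoactLinear.
Variables (H B : lmodType R) (lam : {linear B -> tens H B}).

Lemma ext_coact_semilinear :
  linear_for (sigma \; *:%R) (fun b => tmap (@ext_in H) (@ext_in B) (lam b)).
Proof.
move=> r x y; rewrite linearP.
exact: (tmap_semilinear (@ext_in_semilinear H) (@ext_in_semilinear B)).
Qed.

Lemma ext_coact_linear : linear (ext_coact lam).
Proof. exact: ext_lift_linear ext_coact_semilinear. Qed.

HB.instance Definition _ :=
  GRing.isLinear.Build S _ _ _ (ext_coact lam) ext_coact_linear.

Lemma ext_coactE b :
  ext_coact lam (ext_in b) = tmap (@ext_in H) (@ext_in B) (lam b).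
Proof. exact: ext_lift_in ext_coact_semilinear _. Qed.

End CoactLinear.

Definition ext_counit (H : lmodType R) (eps : H -> R^o) : ext H -> S^o :=
  ext_lift (fun h => sigma (eps h) : S^o).

Section CounitLinear.
Variables (H : lmodType R) (eps : {linear H -> R^o}).

Lemma ext_counit_semilinear :
  linear_for (sigma \; *:%R) (fun h => sigma (eps h) : S^o).
Proof. by move=> r x y; rewrite linearP rmorphD rmorphM. Qed.

Lemma ext_counit_linear : linear (ext_counit eps).
Proof. exact: ext_lift_linear ext_counit_semilinear. Qed.

HB.instance Definition _ :=
  GRing.isLinear.Build S _ _ _ (ext_counit eps) ext_counit_linear.

Lemma ext_counitE h : ext_counit eps (ext_in h) = sigma (eps h).
Proof. exact: ext_lift_in ext_counit_semilinear _. Qed.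

End CounitLinear.

HB.instance Definition _ (H : algType R) := GRing.PzRing.copy (ext H) (tens Ss H).

Section Bialgebra.
Variable H : bialgType R.

Lemma ext_in_monoid : monoid_morphism (@ext_in H : H -> ext H).
Proof.
split=> // x y; rewrite /ext_in -[RHS]/(tens_mul _ _).
by rewrite tens_mulE mulr1.
Qed.

Lemma ext_oner_neq0 : (1 : ext H) != 0.
Proof.
apply/eqP => /(congr1 (ext_counit counit)); rewrite linear0.
rewrite -ext_in_monoid.1 ext_counitE counit_monoid_morphism.1 rmorph1.
exact/eqP/oner_neq0.
Qed.

HB.instance Definition _ := GRing.PzSemiRing_isNonZero.Build (ext H) ext_oner_neq0.

Lemma ext_scaleAl (a : S) (u v : ext H) : a *: (u * v) = (a *: u) * v.
Proof.
elim/tens_ind: u => [|c h u IHu]; first by rewrite !(scaler0, mul0r).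
rewrite mulrDl !scalerDr mulrDl {}IHu; congr (_ + _).
elim/tens_ind: v => [|d g v IHv]; first by rewrite !(scaler0, mulr0).
rewrite !mulrDr scalerDr {}IHv; congr (_ + _).
by rewrite ext_scalepE -![_ * _ in LHS]/(tens_mul _ _) -[RHS]/(tens_mul _ _)
  !tens_mulE ext_scalepE mulrA.
Qed.
HB.instance Definition _ := GRing.Lmodule_isLalgebra.Build S (ext H) ext_scaleAl.

Lemma ext_scaleAr (a : S) (u v : ext H) : a *: (u * v) = u * (a *: v).
Proof.
elim/tens_ind: u => [|c h u IHu]; first by rewrite !(scaler0, mul0r).
rewrite mulrDl !scalerDr mulrDl {}IHu; congr (_ + _).
elim/tens_ind: v => [|d g v IHv]; first by rewrite !(scaler0, mulr0).
rewrite !mulrDr !scalerDr mulrDr {}IHv; congr (_ + _).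
by rewrite ext_scalepE -![_ * _ in LHS]/(tens_mul _ _) -[RHS]/(tens_mul _ _)
  !tens_mulE ext_scalepE mulrCA.
Qed.
HB.instance Definition _ := GRing.Lalgebra_isAlgebra.Build S (ext H) ext_scaleAr.

Definition ext_comul : {linear ext H -> tens (ext H) (ext H)} :=
  ext_coact (@comul _ H).
Definition ext_counit_lin : {linear ext H -> S^o} := ext_counit (@counit _ H).

Let inP := @ext_in_semilinear H.
Let inM := ext_in_monoid.
Let ind := @ext_ind H.
Let cE := ext_coactE (@comul _ H).
Let eE := ext_counitE (@counit _ H).

HB.instance Definition _ := isBialgebra.Build S (ext H)
  (@transport_comulA _ _ _ _ _ _ inP ind ext_comul cE)
  (@transport_counitl _ _ _ _ _ _ inP ind ext_comul ext_counit_lin cE eE)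
  (@transport_counitr _ _ _ _ _ _ inP ind ext_comul ext_counit_lin cE eE)
  (@transport_comulM _ _ _ _ _ _ inP inM ind ext_comul cE)
  (@transport_counitM _ _ _ _ _ _ inM ind ext_counit_lin eE).

End Bialgebra.
End BaseChange.

Section Laurent.
Variables (k0 k : fieldType) (iota : {rmorphism k0 -> k}) (q : k).

(* k0[q, q^-1] as a subring of k, for q transcendental over k0. *)
Definition laurent_pred of ~ algebraicOver iota q : {pred k} :=
  [pred x | `[< exists (p : {poly k0}) (n : nat),
                  x = (map_poly iota p).[q] / q ^+ n >]].

Variable hq : ~ algebraicOver iota q.

Lemma transc_neq0 : q != 0.
Proof. by apply/eqP => q0; apply: hq; rewrite q0; apply: algebraic0. Qed.

Lemma laurent_closed : subring_closed (laurent_pred hq).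
Proof.
split.
- by apply/asboolP; exists 1, 0; rewrite rmorph1 hornerC expr0 divr1.
- move=> _ _ /asboolP[p [n ->]] /asboolP[p' [n' ->]]; apply/asboolP.
  exists (p * 'X^n' - p' * 'X^n), (n + n')%N.
  rewrite rmorphB !rmorphM /= !map_polyXn !hornerE exprD.
  by field; rewrite !expf_neq0 ?transc_neq0.
move=> _ _ /asboolP[p [n ->]] /asboolP[p' [n' ->]]; apply/asboolP.
exists (p * p'), (n + n')%N.
by rewrite rmorphM hornerM exprD invfM mulrACA.
Qed.

HB.instance Definition _ := GRing.isSubringClosed.Build k (laurent_pred hq)
  laurent_closed.

Record laurent := Laurent { laurent_val : k; _ : laurent_val \in laurent_pred hq }.

HB.instance Definition _ := [isSub for laurent_val].
HB.instance Definition _ := [Choice of laurent by <:].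
HB.instance Definition _ := [SubChoice_isSubComNzRing of laurent by <:].

Lemma laurentP (x : laurent) :
  exists (p : {poly k0}) (n : nat), val x = (map_poly iota p).[q] / q ^+ n.
Proof. exact/asboolP/(valP x). Qed.

Definition laurent_incl : laurent -> k := val.
HB.instance Definition _ := GRing.RMorphism.copy laurent_incl (val : laurent -> k).

Lemma laurent_const_subproof a : iota a \in laurent_pred hq.
Proof. by apply/asboolP; exists a%:P, 0; rewrite map_polyC hornerC divr1. Qed.
Definition laurent_const a : laurent := Laurent (laurent_const_subproof a).

Lemma laurent_const_is_zmod : zmod_morphism laurent_const.
Proof. by move=> a b; apply: val_inj; rewrite /= rmorphB. Qed.
Lemma laurent_const_is_monoid : monoid_morphism laurent_const.
Proof.
by split=> [|a b]; apply: val_inj; rewrite /= (rmorph1, rmorphM).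
Qed.
HB.instance Definition _ := GRing.isZmodMorphism.Build _ _ laurent_const
  laurent_const_is_zmod.
HB.instance Definition _ := GRing.isMonoidMorphism.Build _ _ laurent_const
  laurent_const_is_monoid.

Lemma laurent_q_subproof : q \in laurent_pred hq.
Proof. by apply/asboolP; exists 'X, 0; rewrite map_polyX hornerX divr1. Qed.
Definition laurent_q : laurent := Laurent laurent_q_subproof.

(* Evaluation at q = 1, inducing R/(q-1)R = k0. *)
Definition laurent_ev1 (x : laurent) : k0 := (sval (cid (laurentP x))).[1].

Lemma laurent_ev1E (x : laurent) p n :
  val x = (map_poly iota p).[q] / q ^+ n -> laurent_ev1 x = p.[1].
Proof.
rewrite /laurent_ev1; case: (cid _) => p' /= [n' ->] /eqP.
rewrite eqr_div ?expf_neq0 ?transc_neq0 // => /eqP e.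
have /(congr1 (horner^~ 1)) : p' * 'X^n = p * 'X^n'.
  apply/eqP; rewrite -subr_eq0; apply/negPn/negP => nz; apply: hq.
  exists (p' * 'X^n - p * 'X^n') => //.
  by rewrite /root rmorphB !rmorphM /= !map_polyXn !hornerE e subrr.
by rewrite !hornerE !expr1n !mulr1.
Qed.

Lemma laurent_ev1_is_zmod : zmod_morphism laurent_ev1.
Proof.
move=> x y; have [p [n xE]] := laurentP x; have [p' [n' yE]] := laurentP y.
rewrite (laurent_ev1E xE) (laurent_ev1E yE).
rewrite (@laurent_ev1E _ (p * 'X^n' - p' * 'X^n) (n + n')).
  by rewrite !hornerE !expr1n !mulr1.
have -> : val (x - y) = val x - val y by [].
rewrite xE yE rmorphB !rmorphM /= !map_polyXn !hornerE exprD.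
by field; rewrite !expf_neq0 ?transc_neq0.
Qed.

Lemma laurent_ev1_is_monoid : monoid_morphism laurent_ev1.
Proof.
split=> [|x y].
  by rewrite (@laurent_ev1E _ 1 0) ?hornerC // !rmorph1 hornerC divr1.
have [p [n xE]] := laurentP x; have [p' [n' yE]] := laurentP y.
rewrite (laurent_ev1E xE) (laurent_ev1E yE).
rewrite (@laurent_ev1E _ (p * p') (n + n')) ?hornerM //.
have -> : val (x * y) = val x * val y by [].
by rewrite xE yE rmorphM hornerM exprD invfM mulrACA.
Qed.

HB.instance Definition _ := GRing.isZmodMorphism.Build _ _ laurent_ev1
  laurent_ev1_is_zmod.
HB.instance Definition _ := GRing.isMonoidMorphism.Build _ _ laurent_ev1
  laurent_ev1_is_monoid.

Lemma laurent_ev1_const a : laurent_ev1 (laurent_const a) = a.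
Proof. by rewrite (@laurent_ev1E _ a%:P 0) ?hornerC // map_polyC hornerC divr1. Qed.

Lemma laurent_ev1_q : laurent_ev1 laurent_q = 1.
Proof. by rewrite (@laurent_ev1E _ 'X 0) ?hornerX // map_polyX hornerX divr1. Qed.

Lemma laurent_ev1_q1 : laurent_ev1 (laurent_q - 1) = 0.
Proof. by rewrite raddfB /= laurent_ev1_q laurent_ev1_is_monoid.1 subrr. Qed.

Lemma laurent_ev1P (x : laurent) :
  exists y, x = laurent_const (laurent_ev1 x) + y * (laurent_q - 1).
Proof.
have [p [n xE]] := laurentP x; rewrite (laurent_ev1E xE).
have /factor_theorem[r rE] : root (p - p.[1]%:P * 'X^n) 1.
  by rewrite /root !hornerE expr1n mulr1 subrr.
have rP : (map_poly iota r).[q] / q ^+ n \in laurent_pred hq.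
  by apply/asboolP; exists r, n.
exists (Laurent rP); apply: val_inj.
rewrite rmorphD rmorphM rmorphB rmorph1 /= xE.
have /(congr1 (fun s => (map_poly iota s).[q])) := rE.
rewrite rmorphB !rmorphM rmorphB /= map_polyXn map_polyX !map_polyC.
rewrite !hornerE => /(canRL (subrK _)) ->.
by field; rewrite expf_neq0 ?transc_neq0.
Qed.

End Laurent.

Section Reduction.
Variables (k0 k : fieldType) (iota : {rmorphism k0 -> k}) (q : k).
Variable hq : ~ algebraicOver iota q.
Local Notation R := (laurent hq).
Local Notation q1 := (laurent_q hq - 1).
Local Notation ev1 := (@laurent_ev1 _ _ iota q hq).

Definition red_pred (A : lmodType R) : {pred A} :=
  [pred x | `[< exists y, x = q1 *: y >]].

Lemma red_pred_closed (A : lmodType R) : zmod_closed (@red_pred A).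
Proof.
split; first by apply/asboolP; exists 0; rewrite scaler0.
move=> _ _ /asboolP[x ->] /asboolP[y ->]; apply/asboolP; exists (x - y).
by rewrite scalerBr.
Qed.
HB.instance Definition _ (A : lmodType R) :=
  GRing.isZmodClosed.Build A (@red_pred A) (@red_pred_closed A).

(* A/(q-1)A *)
Definition red (A : lmodType R) : Type := Quotient.quot (@red_pred A).
HB.instance Definition _ (A : lmodType R) := GRing.Zmodule.copy (red A)
  (Quotient.quot (@red_pred A)).

Section Module.
Variable A : lmodType R.

Definition red_pi (a : A) : red A := \pi_(Quotient.quot (@red_pred A)) a.
Definition red_repr (x : red A) : A :=
  repr (x : Quotient.quot (@red_pred A)).

Lemma red_reprK : cancel red_repr red_pi.
Proof. exact: reprK. Qed.

Lemma red_piB a b : red_pi (a - b) = red_pi a - red_pi b.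
Proof. exact: pi_is_zmod_morphism. Qed.

Lemma red_pi0 : red_pi 0 = 0.
Proof. by rewrite -(subrr 0) red_piB subrr. Qed.

Lemma red_piN a : red_pi (- a) = - red_pi a.
Proof. by rewrite -sub0r red_piB red_pi0 sub0r. Qed.

Lemma red_piD a b : red_pi (a + b) = red_pi a + red_pi b.
Proof. by rewrite -{1}[b]opprK red_piB red_piN opprK. Qed.

Lemma red_piP a b : red_pi a = red_pi b <-> exists c, a - b = q1 *: c.
Proof.
split=> [e|[c abc]].
  have : a - b \in @red_pred A by rewrite Quotient.idealrBE; apply/eqP; exact: e.
  by move/asboolP.
have : a - b \in @red_pred A by apply/asboolP; exists c.
by rewrite Quotient.idealrBE => /eqP.
Qed.

Lemma red_ind (P : red A -> Prop) : (forall a, P (red_pi a)) -> forall x, P x.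
Proof. by move=> Ppi x; rewrite -[x]red_reprK. Qed.

Lemma red_pi_q1 a : red_pi (q1 *: a) = 0.
Proof. by rewrite -red_pi0; apply/red_piP; exists a; rewrite subr0. Qed.

Definition red_scale (c : k0) (x : red A) : red A :=
  red_pi (laurent_const hq c *: red_repr x).

Lemma red_scaleE c a : red_scale c (red_pi a) = red_pi (laurent_const hq c *: a).
Proof.
apply/red_piP; have /red_piP[b ab] := red_reprK (red_pi a).
by exists (laurent_const hq c *: b); rewrite -scalerBr ab !scalerA mulrC.
Qed.

Lemma red_scaleA b c x : red_scale b (red_scale c x) = red_scale (b * c) x.
Proof. by elim/red_ind: x => a; rewrite !red_scaleE scalerA rmorphM. Qed.
Lemma red_scale1 : left_id 1 red_scale.
Proof. by elim/red_ind => a; rewrite red_scaleE rmorph1 scale1r. Qed.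
Lemma red_scaleDr : right_distributive red_scale +%R.
Proof.
move=> c x y; elim/red_ind: x => a; elim/red_ind: y => b.
by rewrite -red_piD !red_scaleE scalerDr red_piD.
Qed.
Lemma red_scaleDl x : {morph red_scale^~ x : a b / a + b}.
Proof.
by move=> b c; elim/red_ind: x => a; rewrite !red_scaleE rmorphD scalerDl red_piD.
Qed.

HB.instance Definition _ := GRing.Zmodule_isLmodule.Build k0 (red A)
  red_scaleA red_scale1 red_scaleDr red_scaleDl.

Lemma red_pi_semilinear : linear_for (ev1 \; *:%R) red_pi.
Proof.
move=> r a b; rewrite red_piD; congr (_ + _).
rewrite [RHS]red_scaleE; have [y {1}->] := laurent_ev1P r.
by rewrite scalerDl red_piD mulrC -scalerA red_pi_q1 addr0.
Qed.

Section Lift.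
Variable V : lmodType k0.

(* Independent of the representative when f is semilinear over R -> k0. *)
Definition red_lift (f : A -> V) (x : red A) : V := f (red_repr x).

Variable f : A -> V.
Hypothesis fP : linear_for (ev1 \; *:%R) f.

Lemma red_lift_pi a : red_lift f (red_pi a) = f a.
Proof.
have /red_piP[b] := red_reprK (red_pi a); move/(canRL (subrK _)) => aE.
by rewrite /red_lift aE fP /= laurent_ev1_q1 scale0r add0r.
Qed.

Lemma red_lift_linear : linear (red_lift f).
Proof.
move=> c x y; elim/red_ind: x => a; elim/red_ind: y => b.
rewrite [c *: _]red_scaleE -red_piD !red_lift_pi fP /=.
by rewrite laurent_ev1_const.
Qed.

End Lift.
End Module.

Definition red_map (A B : lmodType R) (phi : A -> B) : red A -> red B :=
  red_lift (fun a => red_pi (phi a)).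

Section MapLinear.
Variables (A B : lmodType R) (phi : {linear A -> B}).

Lemma red_map_semilinear : linear_for (ev1 \; *:%R) (fun a => red_pi (phi a)).
Proof. by move=> r a b; rewrite linearP red_pi_semilinear. Qed.

Lemma red_map_linear : linear (red_map phi).
Proof. exact: red_lift_linear red_map_semilinear. Qed.
HB.instance Definition _ :=
  GRing.isLinear.Build k0 _ _ _ (red_map phi) red_map_linear.

Lemma red_mapE a : red_map phi (red_pi a) = red_pi (phi a).
Proof. exact: red_lift_pi red_map_semilinear _. Qed.

End MapLinear.

(* B/(q-1)B -> (H ⊗ B)/(q-1)(H ⊗ B) = H/(q-1)H ⊗ B/(q-1)B over k0 *)
Definition red_coact (H B : lmodType R) (lam : B -> tens H B) :
    red B -> tens (red H) (red B) :=
  red_lift (fun b => tmap (@red_pi H) (@red_pi B) (lam b)).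

Section CoactLinear.
Variables (H B : lmodType R) (lam : {linear B -> tens H B}).

Lemma red_coact_semilinear :
  linear_for (ev1 \; *:%R) (fun b => tmap (@red_pi H) (@red_pi B) (lam b)).
Proof.
move=> r x y; rewrite linearP.
exact: (tmap_semilinear (@red_pi_semilinear H) (@red_pi_semilinear B)).
Qed.

Lemma red_coact_linear : linear (red_coact lam).
Proof. exact: red_lift_linear red_coact_semilinear. Qed.
HB.instance Definition _ :=
  GRing.isLinear.Build k0 _ _ _ (red_coact lam) red_coact_linear.

Lemma red_coactE b :
  red_coact lam (red_pi b) = tmap (@red_pi H) (@red_pi B) (lam b).
Proof. exact: red_lift_pi red_coact_semilinear _. Qed.

End CoactLinear.

Definition red_counit (H : lmodType R) (eps : H -> R^o) : red H -> k0^o :=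
  red_lift (fun h => ev1 (eps h) : k0^o).

Section CounitLinear.
Variables (H : lmodType R) (eps : {linear H -> R^o}).

Lemma red_counit_semilinear :
  linear_for (ev1 \; *:%R) (fun h => ev1 (eps h) : k0^o).
Proof. by move=> r x y; rewrite linearP rmorphD rmorphM. Qed.

Lemma red_counit_linear : linear (red_counit eps).
Proof. exact: red_lift_linear red_counit_semilinear. Qed.
HB.instance Definition _ :=
  GRing.isLinear.Build k0 _ _ _ (red_counit eps) red_counit_linear.

Lemma red_counitE h : red_counit eps (red_pi h) = ev1 (eps h).
Proof. exact: red_lift_pi red_counit_semilinear _. Qed.

End CounitLinear.

Section Ring.
Variable H : algType R.

Definition red_mul (x y : red H) : red H := red_pi (red_repr x * red_repr y).

Lemma red_mulE a b : red_mul (red_pi a) (red_pi b) = red_pi (a * b).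
Proof.
have /red_piP[c ac] := red_reprK (red_pi a).
have /red_piP[d bd] := red_reprK (red_pi b).
apply/red_piP; exists (c * red_repr (red_pi b) + a * d).
rewrite scalerDr scalerAl -ac scalerAr -bd mulrBl mulrBr.
by rewrite addrA subrK.
Qed.

Lemma red_mulA : associative red_mul.
Proof.
by elim/red_ind=> a; elim/red_ind=> b; elim/red_ind=> c; rewrite !red_mulE mulrA.
Qed.
Lemma red_mul1 : left_id (red_pi 1) red_mul.
Proof. by elim/red_ind=> a; rewrite red_mulE mul1r. Qed.
Lemma red_mulr1 : right_id (red_pi 1) red_mul.
Proof. by elim/red_ind=> a; rewrite red_mulE mulr1. Qed.
Lemma red_mulDl : left_distributive red_mul +%R.
Proof.
elim/red_ind=> a; elim/red_ind=> b; elim/red_ind=> c.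
by rewrite -red_piD !red_mulE mulrDl red_piD.
Qed.
Lemma red_mulDr : right_distributive red_mul +%R.
Proof.
elim/red_ind=> a; elim/red_ind=> b; elim/red_ind=> c.
by rewrite -red_piD !red_mulE mulrDr red_piD.
Qed.

HB.instance Definition _ := GRing.Zmodule_isPzRing.Build (red H)
  red_mulA red_mul1 red_mulr1 red_mulDl red_mulDr.

Lemma red_pi_monoid : monoid_morphism (@red_pi H : H -> red H).
Proof. by split=> // a b; rewrite [RHS]red_mulE. Qed.

End Ring.

Section Bialgebra.
Variable H : bialgType R.

Lemma red_oner_neq0 : (1 : red H) != 0.
Proof.
apply/eqP => /(congr1 (red_counit counit)); rewrite linear0.
rewrite -(red_pi_monoid H).1 red_counitE counit_monoid_morphism.1 rmorph1.
exact/eqP/oner_neq0.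
Qed.
HB.instance Definition _ :=
  GRing.PzSemiRing_isNonZero.Build (red H) red_oner_neq0.

Lemma red_scaleAl (a : k0) (u v : red H) : a *: (u * v) = (a *: u) * v.
Proof.
have mE (x y : red H) : x * y = red_mul x y by [].
have sE (x : red H) : a *: x = red_scale a x by [].
elim/red_ind: u => x; elim/red_ind: v => y.
by rewrite !mE !sE red_mulE !red_scaleE red_mulE scalerAl.
Qed.
HB.instance Definition _ := GRing.Lmodule_isLalgebra.Build k0 (red H) red_scaleAl.

Lemma red_scaleAr (a : k0) (u v : red H) : a *: (u * v) = u * (a *: v).
Proof.
have mE (x y : red H) : x * y = red_mul x y by [].
have sE (x : red H) : a *: x = red_scale a x by [].
elim/red_ind: u => x; elim/red_ind: v => y.
by rewrite !mE !sE red_mulE !red_scaleE red_mulE scalerAr.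
Qed.
HB.instance Definition _ := GRing.Lalgebra_isAlgebra.Build k0 (red H) red_scaleAr.

Definition red_comul : {linear red H -> tens (red H) (red H)} :=
  red_coact (@comul _ H).
Definition red_counit_lin : {linear red H -> k0^o} := red_counit (@counit _ H).

Lemma red_gen (P : red H -> Prop) : P 0 ->
  (forall a h x, P x -> P (a *: red_pi h + x)) -> forall x, P x.
Proof.
move=> P0 PD; elim/red_ind => h; have := PD 1 h 0 P0.
by rewrite scale1r addr0.
Qed.

Let piP := @red_pi_semilinear H.
Let piM := red_pi_monoid H.
Let cE := red_coactE (@comul _ H).
Let eE := red_counitE (@counit _ H).

HB.instance Definition _ := isBialgebra.Build k0 (red H)
  (@transport_comulA _ _ _ _ _ _ piP red_gen red_comul cE)
  (@transport_counitl _ _ _ _ _ _ piP red_gen red_comul red_counit_lin cE eE)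
  (@transport_counitr _ _ _ _ _ _ piP red_gen red_comul red_counit_lin cE eE)
  (@transport_comulM _ _ _ _ _ _ piP piM red_gen red_comul cE)
  (@transport_counitM _ _ _ _ _ _ piM red_gen red_counit_lin eE).

End Bialgebra.
End Reduction.

Arguments laurent_incl {k0 k iota q} hq _.
Arguments red_map {k0 k iota q} hq {A B} phi _.
Arguments red_coact {k0 k iota q} hq {H B} lam _.
Arguments ext_map {R S} sigma {A B} phi _.
Arguments ext_coact {R S} sigma {H B} lam _.

Definition torsion_free (R : comNzRingType) (M : lmodType R) : Prop :=
  forall (r : R) (x : M), r *: x = 0 -> r = 0 \/ x = 0.

Definition direct_decomposition (R : comNzRingType) (M : lmodType R) (J : eqType)
    (S : J -> {pred M}) : Prop :=
  [/\ forall j, submod_closed (S j),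
      forall x, exists (s : seq J) (f : J -> M),
        [/\ uniq s, forall j, f j \in S j & x = \sum_(j <- s) f j]
    & forall (s : seq J) (f : J -> M), uniq s -> (forall j, f j \in S j) ->
        \sum_(j <- s) f j = 0 -> forall j, j \in s -> f j = 0].

Definition fin_generated (R : comNzRingType) (M : lmodType R)
    (S : {pred M}) : Prop :=
  exists (n : nat) (g : 'I_n -> M), (forall i, g i \in S) /\
    forall x, x \in S -> exists c : 'I_n -> R, x = \sum_i c i *: g i.

(* The image of H ⊗ S in H ⊗ M; when S is a direct summand of M, the map
   H ⊗ S -> H ⊗ M is injective. *)
Definition tens_sub (R : comNzRingType) (H M : lmodType R) (S : {pred M})
    (t : tens H M) : Prop :=
  exists (n : nat) (h : 'I_n -> H) (b : 'I_n -> M),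
    (forall i, b i \in S) /\ t = \sum_i tpure (h i) (b i).

(* Main.v *)
Require Import Defs.
From HB Require Import structures.
From mathcomp Require Import all_boot all_algebra.
From mathcomp Require Import ring boolp classical_sets.

Set Implicit Arguments.
Unset Strict Implicit.
Unset Printing Implicit Defensive.

Import GRing.Theory.

Local Open Scope ring_scope.
Local Open Scope classical_set_scope.

(* R = k0[q, 1/q] is a Euclidean domain, so a finitely generated submodule of
   a torsion-free R-module lies in a free one; hence torsion-free modules, such
   as k, H and B, are flat.  By flatness the coinvariants of k ⊗ B are spanned
   by C, the coinvariants of B, and H ⊗ B is torsion-free, so that
   (q - 1) b in C implies b in C.  An element c of C is coinvariant modulo
   q - 1, whence c = phi(a) + (q - 1) b, and here b is again in C.  After
   projecting to finitely many summands this happens inside a finitely generated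
   module, and Nakayama's lemma gives d <> 0 with d C inside phi(A) there;
   finally d is invertible in k. *)

(** * Modules over a Euclidean ring *)

Definition euclidean (R : comNzRingType) : Prop :=
  exists N : R -> nat, forall x y : R, y != 0 ->
    exists a r, x = a * y + r /\ (r != 0 -> (N r < N y)%N).

Section Euclidean.
Variable R : comNzRingType.
Hypothesis eucR : euclidean R.

(** Descent on the norm: a nonzero element of [I] that fails to divide some member of [I] leaves a
    nonzero remainder in [I] of smaller norm. *)
Lemma euclidean_principal (I : R -> Prop) :
    I 0 -> (forall a x y, I x -> I y -> I (a * x + y)) ->
  exists2 d, I d & forall x, I x -> exists a, x = a * d.
Proof.
case: eucR => N divN I0 IP.
have [allz|] := pselect (forall x, I x -> x = 0).
  by exists 0 => // x /allz ->; exists 0; rewrite mul0r.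
move=> /existsNP[x /not_implyP[Ix /eqP x0]].
have [n] := ubnP (N x); elim: n x Ix x0 => // n IHn x Ix x0 Nx.
have [dvd|] := pselect (forall y, I y -> exists a, y = a * x); first by exists x.
move=> /existsNP[y /not_implyP[Iy ndvd]].
have [a [r [yE rN]]] := divN y x x0.
have Ir : I r by have := IP (- a) x y Ix Iy; rewrite yE mulNr addKr.
have r0 : r != 0.
  by apply/eqP => r0; apply: ndvd; exists a; rewrite yE r0 addr0.
by apply: (IHn r) => //; apply: leq_trans (rN r0) _.
Qed.

(** The Noetherian property, by induction on [n]: the coefficients at [g ord0] form a principal
    ideal, and an element of [P] realizing its generator reduces [P] to the span of the other
    [g i]. *)
Lemma submodule_fin_generated (M : lmodType R) n (g : 'I_n -> M) (P : {pred M}) :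
    submod_closed P ->
    (forall x, x \in P -> exists c : 'I_n -> R, x = \sum_i c i *: g i) ->
  fin_generated P.
Proof.
elim: n g P => [|n IHn] g P [P0 PD] genP.
  exists 0, (fun _ => 0); split=> [[]|x /genP[c ->]] //.
  by exists c; rewrite !big_ord0.
pose tl (c : 'I_n -> R) := \sum_i c i *: g (lift ord0 i).
(* The family [g] may have relations, so the ideal collects the coefficients at [g ord0] over all
   expressions of elements of [P]. *)
have [||d [cd dP] dvd] := @euclidean_principal
    (fun c0 => exists c, c0 *: g ord0 + tl c \in P).
- exists (fun _ => 0); rewrite scale0r add0r /tl big1 // => i _.
  by rewrite scale0r.
- move=> a x y [c cP] [c' c'P]; exists (fun i => a * c i + c' i).
  have -> : tl (fun i => a * c i + c' i) = a *: tl c + tl c'.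
    rewrite scaler_sumr -big_split; apply: eq_bigr => i _ /=.
    by rewrite scalerDl scalerA.
  have := PD a _ _ cP c'P.
  by rewrite scalerDr scalerA addrACA -scalerDl.
set x0 := _ + _ in dP.
pose Q : {pred M} := [pred x | (x \in P) && `[< exists c, x = tl c >]].
have Qcl : submod_closed Q.
  split=> [|a u v].
    rewrite inE P0; apply/asboolP; exists (fun _ => 0).
    by rewrite /tl big1 // => i _; rewrite scale0r.
  rewrite !inE => /andP[uP /asboolP[c uE]] /andP[vP /asboolP[c' vE]].
  rewrite PD //=; apply/asboolP; exists (fun i => a * c i + c' i).
  rewrite uE vE scaler_sumr -big_split; apply: eq_bigr => i _ /=.
  by rewrite scalerDl scalerA.
have [x|m [h [hQ hgen]]] := IHn (fun i => g (lift ord0 i)) Q Qcl.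
  by rewrite inE => /andP[_ /asboolP].
exists m.+1, (fun i => if unlift ord0 i is Some j then h j else x0); split.
  move=> i; case: unliftP => [j _|_] //.
  by have := hQ j; rewrite inE => /andP[].
move=> x xP; have [c xE] := genP x xP.
have [|a aE] := dvd (c ord0).
  exists (fun i => c (lift ord0 i)).
  by rewrite /tl -(big_ord_recl _ (fun i => c i *: g i)) -xE.
have [|e eE] := hgen (x - a *: x0).
  rewrite inE; apply/andP; split.
    by rewrite addrC -scaleNr PD.
  apply/asboolP; exists (fun i => c (lift ord0 i) - a * cd i).
  rewrite xE big_ord_recl /x0 aE scalerDr scalerA.
  rewrite [X in X - _]addrC opprD addrA addrK /tl scaler_sumr -sumrB; apply: eq_bigr => i _.
  by rewrite scalerBl scalerA.
exists (fun i => if unlift ord0 i is Some j then e j else a).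
rewrite big_ord_recl unlift_none -[LHS](subrK (a *: x0)) eE addrC.
by congr (_ + _); apply: eq_bigr => i _; rewrite liftK.
Qed.

Section TorsionFree.
Variable M : lmodType R.
Hypothesis tfM : torsion_free M.

(** Euclid's algorithm on the coefficients of the relation, with [c i0] as pivot. Once the pivot
    divides all of them, torsion-freeness cancels it and [g i0] is a combination of the others. *)
Lemma dependent_family_shrink n (g : 'I_n.+1 -> M) (c : 'I_n.+1 -> R) i0 :
    c i0 != 0 -> \sum_i c i *: g i = 0 ->
  exists h : 'I_n -> M, forall i, exists d : 'I_n -> R, g i = \sum_j d j *: h j.
Proof.
case: eucR => N divN; have [m] := ubnP (N (c i0)).
elim: m g c i0 => // m IHm g c i0 Nc c0 cg0.
have [dvd|] := pselect (forall j, exists a, c j = a * c i0).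
  (* The quotient at [i0] is set to [1], so that the relation can be solved for [g i0]. *)
  pose a j := if j == i0 then 1 else sval (cid (dvd j)).
  have aE j : c j = a j * c i0.
    rewrite /a; case: eqP => [->|_]; first by rewrite mul1r.
    by case: cid.
  have ag0 : \sum_i a i *: g i = 0.
    have [|/eqP|] // := tfM (r := c i0) (x := \sum_i a i *: g i).
      rewrite scaler_sumr -[RHS]cg0; apply: eq_bigr => i _.
      by rewrite scalerA mulrC -aE.
    by rewrite (negPf c0).
  exists (fun j => g (lift i0 j)) => i; case: (unliftP i0 i) => [j ->|->].
    exists (fun j' => (j' == j)%:R).
    rewrite (bigD1 j) //= eqxx scale1r big1 ?addr0 // => j' /negPf ->.
    by rewrite scale0r.
  exists (fun j => - a (lift i0 j)).
  move: ag0; rewrite (bigD1_ord i0) //= {1}/a eqxx scale1r => /eqP.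
  rewrite addr_eq0 => /eqP ->; rewrite -sumrN.
  by apply: eq_bigr => j _; rewrite scaleNr.
move=> /existsNP[j ndvd]; have [a [r [cjE rN]]] := divN (c j) (c i0) c0.
have r0 : r != 0.
  by apply/eqP => r0; apply: ndvd; exists a; rewrite cjE r0 addr0.
have ji0 : j != i0.
  by apply/eqP => ji0; apply: ndvd; exists 1; rewrite ji0 mul1r.
(* [c i0 *: g i0 + c j *: g j = c i0 *: (g i0 + a *: g j) + r *: g j]: the span is the same, and the
   coefficient [r] at [j] is a pivot of smaller norm. *)
pose g' i := if i == i0 then g i0 + a *: g j else g i.
pose c' i := if i == j then r else c i.
have [||| h hP] := IHm g' c' j.
- by rewrite /c' eqxx; apply: leq_trans (rN r0) _.
- by rewrite /c' eqxx.
- rewrite -[RHS]cg0 (bigD1 i0) // (bigD1 j) //= [RHS](bigD1 i0) //.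
  rewrite [in RHS](bigD1 j) //= !addrA.
  congr (_ + _); last first.
    by apply: eq_bigr => i /andP[/negPf ii0 /negPf ij]; rewrite /g' /c' ii0 ij.
  rewrite /g' /c' !eqxx eq_sym (negPf ji0) cjE scalerDr scalerDl scalerA.
  by rewrite [c i0 * a]mulrC addrA.
exists h => i; have [e eE] := hP i; have [->|ii0] := eqVneq i i0.
  have [e0 e0E] := hP i0; have [ej ejE] := hP j.
  exists (fun l => e0 l - a * ej l).
  move: e0E ejE; rewrite /g' eqxx (negPf ji0) => /(canRL (addrK _)) -> ->.
  rewrite scaler_sumr -sumrB; apply: eq_bigr => l _.
  by rewrite scalerBl scalerA.
by exists e; rewrite -eE /g' (negPf ii0).
Qed.

(** As long as a family has a nontrivial relation, it lies in the span of a family with one vector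
    fewer; the induction ends at a free family. *)
Lemma free_overfamily n (g : 'I_n -> M) :
  exists m (h : 'I_m -> M),
    (forall c : 'I_m -> R, \sum_i c i *: h i = 0 -> forall i, c i = 0) /\
    forall i, exists d : 'I_m -> R, g i = \sum_j d j *: h j.
Proof.
elim: n g => [|n IHn] g; first by exists 0, g; split=> [c _|] [].
have [free|] := pselect
    (forall c : 'I_n.+1 -> R, \sum_i c i *: g i = 0 -> forall i, c i = 0).
  exists n.+1, g; split=> // i; exists (fun j => (j == i)%:R).
  rewrite (bigD1 i) //= eqxx scale1r big1 ?addr0 // => j /negPf ->.
  by rewrite scale0r.
move=> /existsNP[c /not_implyP[cg0 /existsNP[i0 /eqP ci0]]].
have [h hP] := dependent_family_shrink ci0 cg0.
have [m [f [ffree fP]]] := IHn h; exists m, f; split=> // i.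
have [d ->] := hP i; pose e j := sval (cid (fP j)).
have eE j : h j = \sum_l e j l *: f l by rewrite /e; case: cid.
exists (fun l => \sum_j d j * e j l).
under [RHS]eq_bigr do rewrite scaler_suml.
rewrite exchange_big; apply: eq_bigr => j _ /=.
by rewrite eE scaler_sumr; apply: eq_bigr => l _; rewrite scalerA.
Qed.

End TorsionFree.
End Euclidean.

(** * Flatness of torsion-free modules *)

(* A functional defined on a submodule [K] of [N] only respects those relations
   between tensors that involve elements of [K]. *)
Lemma tens_rel_functional (R : comNzRingType) (N M : lmodType R)
    (s t : seq (N * M)) : tens_rel s t ->
  exists G : seq N, forall (K : {pred N}) (c : N -> R), submod_closed K ->
    (forall a, {in K &, forall x y, c (a *: x + y) = a * c x + c y}) ->
    {subset G <= K} ->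
  \sum_(p <- s) c p.1 *: p.2 = \sum_(p <- t) c p.1 *: p.2.
Proof.
elim=> {s t}.
- by move=> s; exists [::].
- by move=> s t _ [G GP]; exists G => K c Kcl cl GK; rewrite (GP K).
- move=> s t u _ [G GP] _ [G' G'P]; exists (G ++ G') => K c Kcl cl GK.
  rewrite (GP K) ?(G'P K) // => x xG; apply: GK;
  by rewrite mem_cat xG ?orbT.
- move=> s s' t t' _ [G GP] _ [G' G'P]; exists (G ++ G') => K c Kcl cl GK.
  rewrite !big_cat /= (GP K) ?(G'P K) // => x xG; apply: GK;
  by rewrite mem_cat xG ?orbT.
- by move=> s t; exists [::] => K c *; rewrite !big_cat /= addrC.
- move=> n; exists [::] => K c [K0 _] cl _; rewrite big_seq1 big_nil /=.
  have := cl (-1) 0 0 K0 K0; rewrite scaler0 addr0 mulN1r addNr => ->.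
  by rewrite scale0r.
- move=> m m' n; exists [:: m; m'] => K c _ cl GK.
  rewrite !big_cons !big_nil !addr0 /= -[m]scale1r cl ?GK ?inE ?eqxx ?orbT //.
  by rewrite scale1r mul1r scalerDl.
- move=> m n n'; exists [::] => K c *.
  by rewrite !big_cons !big_nil !addr0 /= scalerDr.
move=> r m n; exists [:: m] => K c [K0 _] cl GK; rewrite !big_seq1 /=.
have mK : m \in K by rewrite GK ?inE.
have c0 : c 0 = 0.
  by have := cl (-1) 0 0 K0 K0; rewrite scaler0 addr0 mulN1r addNr.
by rewrite -[r *: m]addr0 cl // c0 addr0 scalerA mulrC.
Qed.

(* The equational criterion of flatness for a torsion-free module: a vanishing
   tensor involves finitely many relations, hence a finitely generated
   submodule of [N], which is contained in a free one. *)
Lemma torsion_free_flat (R : comNzRingType) (N M : lmodType R)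
    (s : seq (N * M)) :
    euclidean R -> torsion_free N -> tens_of s = 0 ->
  exists n (f : 'I_n -> N) (r : N -> 'I_n -> R),
    (forall p, p \in s -> p.1 = \sum_i r p.1 i *: f i) /\
    (forall i, \sum_(p <- s) r p.1 i *: p.2 = 0).
Proof.
move=> eucR tfN /tens_of_inj/tens_rel_functional[G GP].
(* [l] gathers the elements used in the relations behind [s] and the first entries of [s]; all of
   them lie in the free submodule [K]. *)
pose l := G ++ [seq p.1 | p <- s].
have [n [f [ffree fgen]]] :=
  free_overfamily eucR tfN (fun i : 'I_(size l) => l`_i).
pose K : {pred N} :=
  [pred x | `[< exists c : 'I_n -> R, x = \sum_i c i *: f i >]].
(* Coordinates along [f], extended by [0] outside [K] to be total on [N]. *)
pose r x : 'I_n -> R :=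
  if pselect (exists c : 'I_n -> R, x = \sum_i c i *: f i) is left h
  then sval (cid h) else fun _ => 0.
have rE x : x \in K -> x = \sum_i r x i *: f i.
  by move/asboolP => xK; rewrite /r; case: pselect => // h; case: cid.
(* Freeness of [f] makes the coordinates unique, hence linear on [K]. *)
have runiq x c : x = \sum_i c i *: f i -> forall i, r x i = c i.
  move=> xE i; have xK : x \in K by apply/asboolP; exists c.
  apply/eqP; rewrite -subr_eq0; apply/eqP.
  apply: (ffree (fun i => r x i - c i)).
  under eq_bigr do rewrite scalerBl.
  by rewrite sumrB -rE // -xE subrr.
have lin a x y : x = \sum_i r x i *: f i -> y = \sum_i r y i *: f i ->
    a *: x + y = \sum_i (a * r x i + r y i) *: f i.
  move=> {1}-> {1}->; rewrite scaler_sumr -big_split; apply: eq_bigr => i _ /=.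
  by rewrite scalerDl scalerA.
have Kcl : submod_closed K.
  split=> [|a x y /rE xE /rE yE]; last by apply/asboolP; eexists; apply: lin.
  apply/asboolP; exists (fun _ => 0); rewrite big1 // => i _.
  by rewrite scale0r.
have lK x : x \in l -> x \in K.
  move=> xl; apply/asboolP; have xi := xl; rewrite -index_mem in xi.
  have [c cE] := fgen (Ordinal xi); exists c.
  by rewrite -cE /= nth_index.
exists n, f, r; split=> [p ps|i].
  by apply/rE/lK; rewrite mem_cat map_f ?orbT.
(* The [i]-th coordinate respects the relations that reduce [s] to the empty list. *)
have -> := GP K (r^~ i); first by rewrite big_nil.
- by [].
- move=> a x y xK yK; apply: (runiq _ (fun i => a * r x i + r y i)).
  by apply: lin; apply: rE.
- by move=> x xG; apply: lK; rewrite mem_cat xG.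
Qed.

Lemma tens_ofE (R : comNzRingType) (N M : lmodType R) (s : seq (N * M)) :
  tens_of s = \sum_(p <- s) tpure p.1 p.2.
Proof.
elim: s => [|[m n] s IHs]; first by rewrite big_nil.
by rewrite big_cons -cat1s tens_ofD IHs.
Qed.

Lemma tpure_suml (R : comNzRingType) (N M : lmodType R) I (s : seq I) (P : pred I)
    (f : I -> N) (m : M) :
  tpure (\sum_(i <- s | P i) f i) m = \sum_(i <- s | P i) tpure (f i) m.
Proof.
by apply: (big_morph (fun x => tpure x m)) => [x y|]; rewrite ?tpureDl ?tpure0l.
Qed.

Lemma tpure_sumr (R : comNzRingType) (N M : lmodType R) I (s : seq I) (P : pred I)
    (n : N) (f : I -> M) :
  tpure n (\sum_(i <- s | P i) f i) = \sum_(i <- s | P i) tpure n (f i).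
Proof.
by apply: (big_morph (fun x => tpure n x)) => [x y|]; rewrite ?tpureDr ?tpure0r.
Qed.

Lemma tens_of_regroup (R : comNzRingType) (N M : lmodType R) (s : seq (N * M))
    n (f : 'I_n -> N) (r : N -> 'I_n -> R) :
    (forall p, p \in s -> p.1 = \sum_i r p.1 i *: f i) ->
  tens_of s = \sum_i tpure (f i) (\sum_(p <- s) r p.1 i *: p.2).
Proof.
move=> rE; rewrite tens_ofE.
under [RHS]eq_bigr do rewrite tpure_sumr.
rewrite exchange_big big_seq [RHS]big_seq; apply: eq_bigr => p ps.
rewrite {1}(rE _ ps) tpure_suml; apply: eq_bigr => i _.
by rewrite tpureZl tpureZr.
Qed.

(** With [r] moved to the right factors, [torsion_free_flat] gives relations that are multiples of
    [r]; torsion-freeness of [M] cancels [r] in them. *)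
Lemma tens_torsion_free (R : comNzRingType) (N M : lmodType R) (r : R) (x : tens N M) :
    euclidean R -> torsion_free N -> torsion_free M ->
  r != 0 -> r *: x = 0 -> x = 0.
Proof.
move=> eucR tfN tfM r0; rewrite -[x]tens_reprK; set s := tens_repr x => rs0.
have : tens_of [seq (p.1, r *: p.2) | p <- s] = 0.
  rewrite -[RHS]rs0 !tens_ofE big_map scaler_sumr.
  by apply: eq_bigr => p _; rewrite tpureZr.
case/(torsion_free_flat eucR tfN) => n [f [c [cE c0]]].
rewrite (@tens_of_regroup _ _ _ _ n f c).
  rewrite big1 // => i _; have := c0 i; rewrite big_map /=.
  under eq_bigr do rewrite scalerA mulrC -scalerA.
  rewrite -scaler_sumr => /tfM[/eqP|->]; last by rewrite tpure0r.
  by rewrite (negPf r0).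
move=> p ps; rewrite -(cE (p.1, r *: p.2)) //=.
exact: (map_f (fun p => (p.1, r *: p.2))).
Qed.

(** * Laurent polynomials: division and Nakayama's lemma *)

Section LaurentEuclidean.
Variables (k0 k : fieldType) (iota : {rmorphism k0 -> k}) (q : k).
Variable hq : ~ algebraicOver iota q.
Local Notation R := (laurent hq).

Lemma laurent_horner_subproof (p : {poly k0}) n :
  (map_poly iota p).[q] / q ^+ n \in laurent_pred hq.
Proof. by apply/asboolP; exists p, n. Qed.

(* The norm of [x] is the least size of a polynomial [p] with
   [x = p(q) / q ^+ n]. *)
Lemma laurent_euclidean : euclidean R.
Proof.
pose sz (x : R) m := `[< exists (p : {poly k0}) n, size p = m /\
  val x = (map_poly iota p).[q] / q ^+ n >].
have szP x : exists m, sz x m.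
  by have [p [n xE]] := laurentP x; exists (size p); apply/asboolP; exists p, n.
exists (fun x => ex_minn (szP x)) => x y y0.
case: ex_minnP => m /asboolP[p [n [<- yE]]] _.
have p0 : p != 0.
  apply: contraNneq y0 => p0; apply/eqP/val_inj.
  by rewrite /= yE p0 rmorph0 horner0 mul0r.
have [p' [n' xE]] := laurentP x.
have qn l : q ^+ l != 0 by rewrite expf_neq0 ?(transc_neq0 hq).
(* Polynomial division of [p'] by [p] over the denominator [q ^+ n']; the factor ['X^n] cancels the
   denominator of [y]. *)
exists (Laurent (laurent_horner_subproof (p' %/ p * 'X^n) n')).
exists (Laurent (laurent_horner_subproof (p' %% p) n')); split.
  apply: val_inj; rewrite rmorphD rmorphM /= xE yE {1}(divp_eq p' p).
  rewrite rmorphD !rmorphM /= map_polyXn !(hornerD, hornerM, hornerXn).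
  by field; rewrite !qn.
move=> _; case: ex_minnP => l _ lmin.
apply: leq_ltn_trans (ltn_modpN0 p' p0).
by apply: lmin; apply/asboolP; exists (p' %% p), n'.
Qed.

(** Makes the flatness criterion applicable to [k] as an [R]-module. *)
Lemma restr_laurent_torsion_free :
  torsion_free (restr (laurent_incl hq) : lmodType R).
Proof.
move=> r x /eqP; rewrite [_ *: _]/(laurent_incl hq r * x :> k) mulf_eq0.
by case/orP => /eqP e; [left; apply: val_inj | right].
Qed.

Lemma laurent_q1_neq0 : laurent_q hq - 1 != 0.
Proof.
apply/eqP => /(congr1 val) /= /eqP; rewrite subr_eq0 => /eqP q1; apply: hq.
by rewrite q1; apply: algebraic1.
Qed.

(* Nakayama's lemma for the ideal generated by [q - 1], by the adjugate: the
   determinant [d] is [1] modulo [q - 1]. *)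
Lemma laurent_nakayama (M : lmodType R) (P Q : {pred M}) :
    fin_generated P -> submod_closed Q ->
    (forall x, x \in P -> exists2 y, y \in P & x - (laurent_q hq - 1) *: y \in Q) ->
  exists2 d : R, d != 0 & forall x, x \in P -> d *: x \in Q.
Proof.
case=> n [g [gP gen]] [Q0 QD] PQ.
have QZ a x : x \in Q -> a *: x \in Q.
  by move=> xQ; rewrite -[a *: x]addr0 QD.
have Qsum (I : finType) (f : I -> M) : (forall i, f i \in Q) -> \sum_i f i \in Q.
  move=> fQ; elim/big_rec: _ => // i x _ xQ; by rewrite -[f i]scale1r QD.
have step i : exists c : 'I_n -> R,
    g i - (laurent_q hq - 1) *: \sum_j c j *: g j \in Q.
  by have [y /gen[c ->] yQ] := PQ _ (gP i); exists c.
pose c i := sval (cid (step i)).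
have cP i : g i - (laurent_q hq - 1) *: \sum_j c i j *: g j \in Q.
  by rewrite /c; case: cid.
(* [A] is the identity minus [(q - 1) c]; by the choice of [c] it sends the generators into [Q]. *)
pose A : 'M[R]_n := \matrix_(i, j) ((i == j)%:R - (laurent_q hq - 1) * c i j).
have AE i : \sum_j A i j *: g j \in Q.
  have := cP i; congr (_ \in Q); rewrite scaler_sumr.
  under [RHS]eq_bigr do rewrite mxE scalerBl.
  rewrite sumrB; congr (_ - _); last by apply: eq_bigr => j _; rewrite scalerA.
  rewrite (bigD1 i) //= eqxx scale1r big1 ?addr0 // => j.
  by rewrite eq_sym => /negPf ->; rewrite scale0r.
have dg i : \det A *: g i \in Q.
  (* The adjugate combines the relations [AE] into [\det A *: g i]. *)
  have -> : \det A *: g i = \sum_l \adj A i l *: \sum_j A l j *: g j.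
    under eq_bigr do rewrite scaler_sumr.
    rewrite exchange_big /= (bigD1 i) //= [X in _ + X]big1 ?addr0 => [|j ji].
      under eq_bigr do rewrite scalerA.
      rewrite -scaler_suml; congr (_ *: _).
      have := congr1 (fun B : 'M_n => B i i) (mul_adj_mx A).
      by rewrite !mxE eqxx mulr1n => <-.
    under eq_bigr do rewrite scalerA.
    rewrite -scaler_suml.
    have := congr1 (fun B : 'M_n => B i j) (mul_adj_mx A).
    by rewrite !mxE eq_sym (negPf ji) mulr0n => ->; rewrite scale0r.
  by apply: Qsum => l; apply/QZ/AE.
exists (\det A); last first.
  move=> x /gen[e ->]; rewrite scaler_sumr; apply: Qsum => i.
  by rewrite scalerA mulrC -scalerA; apply/QZ/dg.
apply/eqP => /(congr1 (@laurent_ev1 _ _ _ _ hq)).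
rewrite -det_map_mx rmorph0.
have -> : map_mx (@laurent_ev1 _ _ _ _ hq) A = 1%:M.
  apply/matrixP => i j; rewrite !mxE rmorphB rmorphM /= laurent_ev1_q1 mul0r subr0.
  by rewrite rmorph_nat.
by rewrite det1 => /eqP; rewrite oner_eq0.
Qed.

End LaurentEuclidean.

(** * Comodules along semilinear maps *)

Section TransportComodule.
Variables (R S : comNzRingType) (sigma : {rmorphism R -> S}).
Variables (H : bialgType R) (H' : bialgType S) (B : lmodType R) (B' : lmodType S).
Variables (pi : H -> H') (rho : B -> B').
Hypothesis piP : linear_for (sigma \; *:%R) pi.
Hypothesis rhoP : linear_for (sigma \; *:%R) rho.
Hypothesis rho_gen : forall P : B' -> Prop, P 0 ->
  (forall a b x, P x -> P (a *: rho b + x)) -> forall x, P x.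
Hypothesis comulE : forall h, comul (pi h) = tmap pi pi (comul h).
Hypothesis counitE : forall h, counit (pi h) = sigma (counit h).
Variables (lam : {linear B -> tens H B}) (lam' : {linear B' -> tens H' B'}).
Hypothesis lamE : forall b, lam' (rho b) = tmap pi rho (lam b).

Let ppP := tmap_semilinear piP piP.
Let prP := tmap_semilinear piP rhoP.
Let pprP := tmap_semilinear ppP rhoP.
Let p_prP := tmap_semilinear piP prP.

Lemma tmap_tassoc (x : tens (tens H H) B) :
  tassoc (tmap (tmap pi pi) rho x) = tmap pi (tmap pi rho) (tassoc x).
Proof.
elim/tens_ind: x => [|y b x IHx].
  by rewrite (semilinear0 pprP) !linear0 (semilinear0 p_prP).
rewrite (semilinearD pprP) !linearD (semilinearD p_prP) /= IHx; congr (_ + _).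
rewrite (tmapE ppP rhoP); elim/tens_ind: y => [|m n y IHy].
  by rewrite (semilinear0 ppP) !tpure0l !linear0 (semilinear0 p_prP).
rewrite (semilinearD ppP) !tpureDl !linearD (semilinearD p_prP) /= IHy.
congr (_ + _).
by rewrite (tmapE piP piP) !tassocE (tmapE piP prP) (tmapE piP rhoP).
Qed.

(** Both axioms compare linear maps on [B'], so it suffices to check them on the [rho b], where
    [lamE] turns them into the axioms for [lam]. This covers reduction modulo [q - 1] and base
    change to [k] at once. *)
Lemma transport_comodule : is_comodule lam -> is_comodule lam'.
Proof.
case=> lamA lam1.
have eq_gen (V : lmodType S) (f g : {linear B' -> V}) :
    (forall b, f (rho b) = g (rho b)) -> f =1 g.
  move=> fg; apply: rho_gen => [|a b x fgx]; first by rewrite !linear0.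
  by rewrite !linearP fg fgx.
split.
  apply: (eq_gen _ (@tassoc _ _ _ _ \o tmap comul idfun \o lam')
                   (tmap idfun lam' \o lam')) => b /=.
  rewrite lamE; transitivity (tmap pi (tmap pi rho) (tmap idfun lam (lam b))).
    rewrite -lamA -tmap_tassoc; congr tassoc.
    elim/tens_ind: (lam b) => [|h b' x IHx].
      by rewrite (semilinear0 prP) !linear0 (semilinear0 pprP).
    rewrite (semilinearD prP) !linearD (semilinearD pprP) /= IHx; congr (_ + _).
    by rewrite (tmapE piP rhoP) !tmap_linE (tmapE ppP rhoP) comulE.
  elim/tens_ind: (lam b) => [|h b' x IHx].
    by rewrite (semilinear0 prP) !linear0 (semilinear0 p_prP).
  rewrite (semilinearD prP) !linearD (semilinearD p_prP) /= IHx; congr (_ + _).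
  by rewrite (tmapE piP rhoP) !tmap_linE (tmapE piP prP) lamE.
apply: (eq_gen _ (@tlid _ _ \o tmap counit idfun \o lam') idfun) => b /=.
rewrite lamE -[in RHS](lam1 b).
elim/tens_ind: (lam b) => [|h b' x IHx].
  by rewrite (semilinear0 prP) !linear0 (semilinear0 rhoP).
rewrite (semilinearD prP) !linearD (semilinearD rhoP) /= IHx; congr (_ + _).
by rewrite (tmapE piP rhoP) !tmap_linE !tlidE counitE (semilinearZ rhoP).
Qed.

End TransportComodule.

(** * Base change of tensor products *)

Section BaseChangeTensor.
Variables (R S : comNzRingType) (sigma : {rmorphism R -> S}) (M N : lmodType R).

(* (S ⊗ M) ⊗_S (S ⊗ N) -> S ⊗ (M ⊗ N) *)
Definition ext_tens_back : tens (ext sigma M) (ext sigma N) -> ext sigma (tens M N) :=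
  tlift (fun u v => ext_lift
    (fun m => ext_lift (fun n => ext_in sigma (tpure m n)) v) u).

Lemma ext_tens_back_semilinear_r m :
  linear_for (sigma \; *:%R) (fun n : N => ext_in sigma (tpure (m : M) n)).
Proof. by move=> r x y; rewrite tpure_linearr; apply: ext_in_semilinear. Qed.

Let rP m := ext_lift_linear (ext_tens_back_semilinear_r m).
Let rE m := ext_lift_in (ext_tens_back_semilinear_r m).

Lemma ext_tens_back_semilinear_l (v : ext sigma N) :
  linear_for (sigma \; *:%R)
    (fun m : M => ext_lift (fun n => ext_in sigma (tpure m n)) v).
Proof.
move=> r x y; elim/ext_ind: v => [|a n v IHv].
  by rewrite !(linear_eq0 (rP _)) /= scaler0 addr0.
rewrite !rP IHv !rE tpure_linearl ext_in_semilinear /= !scalerDr !scalerA.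
by rewrite [a * _]mulrC addrACA.
Qed.

Let lP v := ext_lift_linear (ext_tens_back_semilinear_l v).
Let lE v := ext_lift_in (ext_tens_back_semilinear_l v).

Lemma ext_tens_back_bilinear_r (u : ext sigma M) :
  linear (fun v : ext sigma N => ext_lift
    (fun m : M => ext_lift (fun n => ext_in sigma (tpure m n)) v) u).
Proof.
move=> a v w; elim/ext_ind: u => [|b m u IHu].
  by rewrite !(linear_eq0 (lP _)) scaler0 addr0.
by rewrite !lP IHu !lE rP !scalerDr !scalerA [b * a]mulrC addrACA.
Qed.

Lemma ext_tens_back_linear : linear ext_tens_back.
Proof. exact: tlift_linear lP ext_tens_back_bilinear_r. Qed.

HB.instance Definition _ :=
  GRing.isLinear.Build S _ _ _ ext_tens_back ext_tens_back_linear.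

(** Brings equations in [(S ⊗ M) ⊗_S (S ⊗ N)] back to [S ⊗ (M ⊗ N)], where, for [S = k], flatness
    over [R] can be used. *)
Lemma ext_tens_backE x :
  ext_tens_back (tmap (@ext_in _ _ sigma M) (@ext_in _ _ sigma N) x)
    = ext_in sigma x.
Proof.
have iP := @ext_in_semilinear _ _ sigma (tens M N).
have pP := tmap_semilinear (@ext_in_semilinear _ _ sigma M)
                           (@ext_in_semilinear _ _ sigma N).
elim/tens_ind: x => [|m n x IHx].
  by rewrite (semilinear0 pP) linear0 (semilinear0 iP).
rewrite (semilinearD pP) linearD (semilinearD iP) /= IHx; congr (_ + _).
rewrite (tmapE (@ext_in_semilinear _ _ sigma M) (@ext_in_semilinear _ _ sigma N)).
rewrite /ext_tens_back tliftE ?lE ?rE //.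
exact: linear_balanced lP ext_tens_back_bilinear_r.
Qed.

End BaseChangeTensor.

(** * Direct decompositions and finite partial sums *)

Section Decomposition.
Variables (R : comNzRingType) (M : lmodType R) (J : eqType) (M_ : J -> {pred M}).

(** Restricts the support to finitely many summands, where finite generation, and so Nakayama's
    lemma, is available. *)
Definition partial_sum (S : seq J) : {pred M} :=
  [pred x | `[< exists f : J -> M,
                  (forall j, f j \in M_ j) /\ x = \sum_(j <- S) f j >]].

Hypothesis hM : direct_decomposition M_.

Lemma partial_sum_closed S : submod_closed (partial_sum S).
Proof.
case: hM => cl _ _; split.
  apply/asboolP; exists (fun _ => 0); split; last by rewrite big1.
  by move=> j; case: (cl j).
move=> a _ _ /asboolP[f [fM ->]] /asboolP[g [gM ->]]; apply/asboolP.
exists (fun j => a *: f j + g j); split.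
  by move=> j; case: (cl j) => _; apply.
by rewrite scaler_sumr -big_split.
Qed.

Lemma partial_sum_generated S : (forall j, fin_generated (M_ j)) ->
  exists n (g : 'I_n -> M), forall x, x \in partial_sum S ->
    exists c : 'I_n -> R, x = \sum_i c i *: g i.
Proof.
move=> fg; elim: S => [|j S [n [g gP]]].
  exists 0, (fun _ => 0) => _ /asboolP[f [_ ->]]; exists (fun _ => 0).
  by rewrite big_nil big_ord0.
have [m [h [_ hP]]] := fg j.
exists (m + n)%N, (fun i => match split i with inl a => h a | inr b => g b end).
move=> _ /asboolP[f [fM ->]]; rewrite big_cons.
have [|d ->] := gP (\sum_(l <- S) f l); first by apply/asboolP; exists f.
have [c ->] := hP _ (fM j).
exists (fun i => match split i with inl a => c a | inr b => d b end).
rewrite big_split_ord; congr (_ + _); apply: eq_bigr => i _.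
  by case: (split _) (unsplitK (inl i : 'I_m + 'I_n)) => ? [] // <-.
by case: (split _) (unsplitK (inr i : 'I_m + 'I_n)) => ? [] // <-.
Qed.

(* Components vanishing outside the list make it possible to compare
   decompositions along different lists. *)
Lemma decomposition_support x : exists (s : seq J) (f : J -> M),
  [/\ forall j, f j \in M_ j, forall j, j \notin s -> f j = 0
    & forall u, uniq u -> {subset s <= u} -> x = \sum_(j <- u) f j].
Proof.
case: hM => cl ex _; have [s [f [us fM xE]]] := ex x.
exists s, (fun j => if j \in s then f j else 0); split.
- by move=> j; case: ifP => _ //; case: (cl j).
- by move=> j /negPf ->.
move=> u uu su; rewrite -big_mkcond /= -big_filter xE; apply: perm_big.
apply: uniq_perm => //; first exact: filter_uniq.
by move=> j; rewrite mem_filter; case js: (j \in s); rewrite //= su.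
Qed.

End Decomposition.

Lemma partial_sum_mod (R : comNzRingType) (A B : lmodType R) (J : eqType)
    (A_ : J -> {pred A}) (B_ : J -> {pred B}) (phi : {linear A -> B})
    (hA : direct_decomposition A_) (hB : direct_decomposition B_)
    (phi_A : forall j a, a \in A_ j -> phi a \in B_ j)
    (S : seq J) (r : R) (c b : B) (a : A) :
    uniq S -> c \in partial_sum B_ S -> c = phi a + r *: b ->
  exists a' b', b' \in partial_sum B_ S /\ c = phi a' + r *: b'.
Proof.
move=> uS /asboolP[h [hM cE]].
have [sa [f [fM f0 fE]]] := decomposition_support hA a.
have [sb [g [gM g0 gE]]] := decomposition_support hB b.
(* [u] contains [S] and the supports of [a] and [b], so that [c], [a] and [b] are all sums over
   [u]. *)
pose u := undup (S ++ sa ++ sb) => cab.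
have uu : uniq u by apply: undup_uniq.
have [cl _ indep] := hB.
pose h' j := if j \in S then h j else 0.
have h'M j : h' j \in B_ j by rewrite /h'; case: ifP => // _; case: (cl j).
have BD j x y t : x \in B_ j -> y \in B_ j -> t *: x + y \in B_ j.
  by case: (cl j) => _; apply.
have memB j : (-1) *: (phi (f j) + r *: g j) + h' j \in B_ j.
  by apply: (BD j) => //; rewrite addrC; apply: (BD j) => //; apply: phi_A.
(* The equation becomes a single vanishing sum, so that independence of the [B_ j] kills each
   term. *)
have e0 : \sum_(j <- u) ((-1) *: (phi (f j) + r *: g j) + h' j) = 0.
  rewrite big_split -scaler_sumr big_split -linear_sum -scaler_sumr /=.
  rewrite -fE // -?gE // => [|j js|j js]; last 2 first.
  - by rewrite mem_undup !mem_cat js !orbT.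
  - by rewrite mem_undup !mem_cat js !orbT.
  rewrite -cab scaleN1r /h' -big_mkcond /= -big_filter.
  rewrite (perm_big S) -?cE ?addNr //.
  apply: uniq_perm => //; first exact: filter_uniq.
  by move=> j; rewrite mem_filter mem_undup mem_cat; case: (j \in S).
have hE j : j \in S -> h j = phi (f j) + r *: g j.
  move=> jS; have ju : j \in u by rewrite mem_undup mem_cat jS.
  have /eqP := indep u _ uu memB e0 j ju.
  by rewrite scaleN1r addrC subr_eq0 /h' jS => /eqP.
exists (\sum_(j <- S) f j), (\sum_(j <- S) g j); split.
  by apply/asboolP; exists g.
rewrite linear_sum scaler_sumr -big_split cE.
by apply: eq_big_seq => j /hE.
Qed.

(** * Coinvariants over [R], modulo [q - 1] and over [k] *)

Lemma tpureBr (R : comNzRingType) (M N : lmodType R) (m : M) (x y : N) :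
  tpure m (x - y) = tpure m x - tpure m y.
Proof. by rewrite -scaleN1r tpureDr tpureZr scaleN1r. Qed.

Section Coinvariants.
Variables (k0 k : fieldType) (iota : {rmorphism k0 -> k}) (q : k).
Variable hq : ~ algebraicOver iota q.
Local Notation R := (laurent hq).
Local Notation sigma := (laurent_incl hq).
Variables (H : bialgType R) (A B : lmodType R).
Variables (lam : {linear B -> tens H B}) (phi : {linear A -> B}).

Lemma coinv_closed : submod_closed [pred b | `[< coinv lam b >]].
Proof.
split=> [|a x y]; first by apply/asboolP; rewrite /coinv /= linear0 tpure0r.
move=> /asboolP/= xC /asboolP/= yC; apply/asboolP; rewrite /coinv /=.
by rewrite linearP xC yC tpure_linearr.
Qed.

Lemma coinv_q1 (b : B) : torsion_free B -> torsion_free H ->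
  coinv lam ((laurent_q hq - 1) *: b) -> coinv lam b.
Proof.
move=> tfB tfH; rewrite /coinv /= linearZ tpureZr => /eqP.
rewrite -subr_eq0 -scalerBr => /eqP e; apply/eqP; rewrite -subr_eq0; apply/eqP.
exact: tens_torsion_free (laurent_euclidean hq) tfH tfB (laurent_q1_neq0 hq) e.
Qed.

Lemma coinv_red_pi (b : B) :
  coinv lam b -> coinv (H := red H) (red_coact hq lam) (red_pi b).
Proof.
move=> bC; rewrite /coinv /= red_coactE bC.
exact: (tmapE (@red_pi_semilinear _ _ _ _ hq H) (@red_pi_semilinear _ _ _ _ hq B)).
Qed.

Lemma coinv_ext_in (b : B) :
  coinv lam b -> coinv (H := ext sigma H) (ext_coact sigma lam) (ext_in sigma b).
Proof.
move=> bC; rewrite /coinv /= ext_coactE bC.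
exact: (tmapE (@ext_in_semilinear _ _ sigma H) (@ext_in_semilinear _ _ sigma B)).
Qed.

(** Coinvariants are the kernel of [mu b = lam b - 1 ⊗ b], and tensoring with the flat module [k]
    preserves kernels. *)
Lemma coinv_ext (x : ext sigma B) :
    coinv (H := ext sigma H) (ext_coact sigma lam) x ->
  exists n (f : 'I_n -> k) (b : 'I_n -> B),
    (forall i, coinv lam (b i)) /\ x = \sum_i f i *: ext_in sigma (b i).
Proof.
set s := tens_repr (x : tens _ B) => xC.
pose mu b := lam b - tpure 1 b.
have xs : x = tens_of s by rewrite tens_reprK.
have xE : x = \sum_(p <- s) (p.1 : k) *: ext_in sigma p.2.
  rewrite {1}xs tens_ofE; apply: eq_bigr => p _.
  by rewrite ext_scalepE mulr1.
(* [ext_tens_back] turns the coinvariance of [x] into the vanishing of the image of [x] under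
   [id ⊗ mu] in [k ⊗ (H ⊗ B)]. *)
have : tens_of [seq (p.1, mu p.2) | p <- s] = 0.
  have : ext_tens_back (ext_coact sigma lam x - tpure (1 : ext sigma H) x) = 0.
    by rewrite xC subrr linear0.
  move=> <-; rewrite tens_ofE big_map [in RHS]xE linear_sum tpure_sumr -sumrB.
  rewrite linear_sum; apply: eq_bigr => p _ /=.
  rewrite linearZ tpureZr -scalerBr linearZ /= ext_coactE linearB /=.
  rewrite ext_tens_backE.
  have -> : tpure (1 : ext sigma H) (ext_in sigma p.2) =
      tmap (@ext_in _ _ sigma H) (@ext_in _ _ sigma B) (tpure 1 p.2).
    by rewrite (tmapE (@ext_in_semilinear _ _ sigma H)
                      (@ext_in_semilinear _ _ sigma B)).
  by rewrite ext_tens_backE /ext_in -tpureBr ext_scalepE mulr1.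
case/(torsion_free_flat (laurent_euclidean hq)
  (@restr_laurent_torsion_free _ _ _ _ hq)) => n [f [r [rE r0]]].
exists n, f, (fun i => \sum_(p <- s) r p.1 i *: p.2); split.
  move=> i; have := r0 i; rewrite big_map /=.
  under eq_bigr do rewrite scalerBr.
  rewrite sumrB => /eqP; rewrite subr_eq0 => /eqP e.
  rewrite /coinv /= linear_sum tpure_sumr.
  under eq_bigr do rewrite linearZ.
  by rewrite e; apply: eq_bigr => p _; rewrite tpureZr.
rewrite {1}xs (@tens_of_regroup _ _ _ _ n f r).
  by apply: eq_bigr => i _; rewrite ext_scalepE mulr1.
move=> p ps; rewrite -(rE (p.1, mu p.2)) //.
exact: (map_f (fun p => (p.1, mu p.2))).
Qed.

(** Nakayama's lemma with [P] the coinvariants supported on finitely many summands whose sum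
    contains [c], and [Q] the image of [phi]. It leaves a denominator [d], which becomes invertible
    in [k]. *)
Lemma coinv_torsion_image (J : eqType) (A_ : J -> {pred A}) (B_ : J -> {pred B})
    (c : B) :
    range phi `<=` coinv lam -> torsion_free B -> torsion_free H ->
    direct_decomposition A_ -> direct_decomposition B_ ->
    (forall j, fin_generated (B_ j)) ->
    (forall j a, a \in A_ j -> phi a \in B_ j) ->
    coinv (H := red H) (red_coact hq lam) `<=` range (red_map hq phi) ->
  coinv lam c -> exists d a, d != 0 /\ d *: c = phi a.
Proof.
move=> hphi tfB tfH hA hB B_fg phi_A redC cC.
have [_ exB _] := hB; have [S [h [uS hM cE]]] := exB c.
pose P : {pred B} := [pred x | (x \in partial_sum B_ S) && `[< coinv lam x >]].
pose Q : {pred B} := [pred x | `[< exists a, x = phi a >]].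
have [pS0 pSD] := partial_sum_closed hB S.
have [C0 CD] := coinv_closed.
have Pcl : submod_closed P.
  split=> [|a x y]; first exact/andP.
  by move=> /andP[xS xC] /andP[yS yC]; apply/andP; split; [apply: pSD | apply: CD].
have Qcl : submod_closed Q.
  split=> [|a _ _ /asboolP[x ->] /asboolP[y ->]]; apply/asboolP.
    by exists 0; rewrite linear0.
  by exists (a *: x + y); rewrite linearP.
have [m [g gP]] := partial_sum_generated S B_fg.
have Pfg : fin_generated P.
  apply: (submodule_fin_generated (laurent_euclidean hq) (g := g)) => // z.
  by move=> /andP[/gP].
have [z|d d0 dP] := laurent_nakayama (hq := hq) Pfg Qcl.
  move=> /andP[zS /asboolP zC].
  have [y _] := redC _ (coinv_red_pi zC); elim/red_ind: y => a.
  rewrite red_mapE => /esym/red_piP[b' /eqP].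
  rewrite subr_eq addrC => /eqP zE.
  (* [b'] may have components outside [S]; projecting yields [b''] supported on [S]. *)
  have [a' [b'' [b''S zE']]] := partial_sum_mod hA hB phi_A uS zS zE.
  exists b''.
    (* [(q - 1) b'' = z - phi a'] is coinvariant, hence so is [b'']. *)
    apply/andP; split=> //; apply/asboolP; apply: (coinv_q1 tfB tfH).
    have /asboolP : (-1) *: phi a' + z \in [pred b | `[< coinv lam b >]].
      by apply: CD; apply/asboolP => //; apply: hphi; exists a'.
    by rewrite scaleN1r zE' addKr.
  by rewrite zE' addrK; apply/asboolP; exists a'.
have cP : c \in P by apply/andP; split; apply/asboolP => //; exists h.
by have /asboolP[a aE] := dP c cP; exists d, a.
Qed.

End Coinvariants.

Theorem theorem1p2 (k0 k : fieldType) (iota : {rmorphism k0 -> k}) (q : k)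
    (hq : ~ algebraicOver iota q)
    (H : bialgType (laurent hq)) (A B : lmodType (laurent hq))
    (lam : {linear B -> tens H B}) (phi : {linear A -> B})
    (hlam : is_comodule lam)
    (hphi : range phi `<=` coinv lam)
    (tfB : torsion_free B) (tfH : torsion_free H)
    (J : eqType) (A_ : J -> {pred A}) (B_ : J -> {pred B})
    (hA : direct_decomposition A_) (hB : direct_decomposition B_)
    (B_fg : forall j, fin_generated (B_ j))
    (phi_A : forall j a, a \in A_ j -> phi a \in B_ j)
    (lam_B : forall j b, b \in B_ j -> tens_sub (B_ j) (lam b)) :
  [/\ is_comodule (H := red H) (red_coact hq lam),
      is_comodule (H := ext (laurent_incl hq) H)
        (ext_coact (laurent_incl hq) lam)
    & coinv (H := red H) (red_coact hq lam) = range (red_map hq phi) ->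
      coinv (H := ext (laurent_incl hq) H) (ext_coact (laurent_incl hq) lam)
        = range (ext_map (laurent_incl hq) phi)].
Proof.
split.
- apply: (transport_comodule (@red_pi_semilinear _ _ _ _ hq H)
    (@red_pi_semilinear _ _ _ _ hq B) _
    (red_coactE (@comul _ H)) (red_counitE (@counit _ H)) (red_coactE lam)) => //.
  move=> P P0 PD; elim/red_ind => b; have := PD 1 b 0 P0.
  by rewrite scale1r addr0.
- exact: (transport_comodule (@ext_in_semilinear _ _ _ H)
    (@ext_in_semilinear _ _ _ B) (@ext_ind _ _ _ B)
    (ext_coactE _ (@comul _ H)) (ext_counitE _ (@counit _ H)) (ext_coactE _ lam)).
move=> redC; apply/seteqP; split=> [x xC|_ [y _ <-]]; last first.
  (* The image is spanned by the [1 ⊗ phi y], which are coinvariant because each [phi y] is. *)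
  elim/ext_ind: y => [|a y z IHz].
    by rewrite linear0 /coinv /= linear0 tpure0r.
  rewrite linearP /coinv /= linearP IHz tpure_linearr; congr (_ *: _ + _).
  by rewrite /ext_in ext_mapE; apply: coinv_ext_in; apply: hphi; exists y.
have [n [f [b [bC ->]]]] := @coinv_ext _ _ _ _ _ _ _ lam _ xC.
(* By [coinv_ext], it remains to reach [1 ⊗ c] for [c] coinvariant over [R]. *)
have step c : coinv lam c ->
    exists y, ext_in (laurent_incl hq) c = ext_map (laurent_incl hq) phi y.
  move=> cC.
  have redC' : coinv (H := red H) (red_coact hq lam) `<=` range (red_map hq phi).
    by rewrite redC.
  have [d [a [d0 aE]]] :=
    coinv_torsion_image hphi tfB tfH hA hB B_fg phi_A redC' cC.
  (* Since [d c = phi a] and [d] is nonzero in [k], [1 ⊗ c = d^-1 (1 ⊗ phi a)]. *)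
  exists ((laurent_incl hq d)^-1 *: ext_in _ a).
  rewrite linearZ /= {2}/ext_in ext_mapE -aE -/(ext_in _ _).
  rewrite (semilinearZ (@ext_in_semilinear _ _ _ B)) scalerA mulVf ?scale1r //.
pose y i := sval (cid (step _ (bC i))).
exists (\sum_i f i *: y i) => //; rewrite linear_sum; apply: eq_bigr => i _ /=.
by rewrite linearZ /= /y; case: cid => z /= ->.
Qed.
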